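(* Let $\Gamma$ be a countable discrete group and $(X,\mu)$ a standard probability space. Suppose $a\in\mathrm{A}(\Gamma,X,\mu)$ is such that its weak equivalence class $[a]$ is an extreme point of $\mathrm{A}_\sim(\Gamma,X,\mu)$. Let $a=\int_Z a_z\,d\eta(z)$ be the ergodic decomposition of $a$. Then there is a measure-preserving action $b$ of $\Gamma$ on a probability space such that for $\eta$-almost all $z\in Z$ the actions $a_z$ and $b$ are weakly equivalent, i.e. $[a_z]=[b]$.
   Context: A probability space is a standard Borel space with a Borel probability measure (atoms allowed, possibly countable or finite); it is a standard probability space if the measure is nonatomic. A measure-preserving action $\Gamma\curvearrowright^a(Y,\nu)$ is a Borel action preserving $\nu$, two actions being identified if they agree almost everywhere; $\gamma^a$ denotes the transformation given by $\gamma\in\Gamma$. $\mathrm{A}(\Gamma,X,\mu)$ is the set of measure-preserving actions of $\Gamma$ on $(X,\mu)$. Weak containment: for measure-preserving actions $a$ on $(Y_1,\nu_1)$ and $b$ on $(Y_2,\nu_2)$ (arbitrary probability spaces), $a\prec b$ if for all measurable $A_1,\dots,A_n\subseteq Y_1$, finite $F\subseteq\Gamma$ and $\epsilon>0$ there are measurable $B_1,\dots,B_n\subseteq Y_2$ with $|\nu_1(\gamma^aA_i\cap A_j)-\nu_2(\gamma^bB_i\cap B_j)|<\epsilon$ for all $\gamma\in F$, $i,j\le n$. Weak equivalence $a\sim b$ means $a\prec b$ and $b\prec a$; $[a]$ denotes the weak equivalence class. $\mathrm{A}_\sim(\Gamma,X,\mu)$ is the quotient of $\mathrm{A}(\Gamma,X,\mu)$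 by $\sim$. Convex structure: for $a,b\in\mathrm{A}(\Gamma,X,\mu)$ and $t\in[0,1]$, $t[a]+(1-t)[b]$ is the weak equivalence class of the action on $X_1\sqcup X_2$ (two copies of $X$, with measure $t\mu$ on $X_1$ and $(1-t)\mu$ on $X_2$) acting as $a$ on $X_1$ and $b$ on $X_2$, transported to $(X,\mu)$ by any isomorphism of probability spaces; this is well defined. A point $x\in\mathrm{A}_\sim(\Gamma,X,\mu)$ is an extreme point if $x=ty+(1-t)z$ with $0<t<1$ and $y,z\in\mathrm{A}_\sim(\Gamma,X,\mu)$ implies $y=z=x$. Ergodic decomposition: $a=\int_Za_z\,d\eta(z)$ means that there is a factor map $\pi:(X,\mu)\to(Z,\eta)$ onto a probability space with trivial $\Gamma$-action such that, if $\mu=\int_Z\mu_z\,d\eta(z)$ is the disintegration of $\mu$ over $\eta$ via $\pi$, then for $\eta$-almost every $z$ one has $\mu_z(\pi^{-1}(z))=1$ and $a_z$ is the restriction of $a$ to $(\pi^{-1}(z),\mu_z)$, which is measure-preserving and ergodic. *)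

(* Defs.v *)
From HB Require Import structures.
From mathcomp Require Import all_boot all_order all_algebra.
From mathcomp Require Import all_classical all_reals all_analysis.

Set Implicit Arguments.
Unset Strict Implicit.
Unset Printing Implicit Defensive.

Import Order.TTheory GRing.Theory Num.Theory.

Local Open Scope classical_set_scope.
Local Open Scope ring_scope.

(* A Polish space is rendered as a separable Hausdorff complete
   pseudometric space. *)
Definition standard_borel (R : realType) d (T : measurableType d) : Prop :=
  exists (P : completePseudoMetricType R) (f : T -> P),
    [/\ hausdorff_space P,
        (exists2 D : set P, countable D & dense D),
        bijective f
      & forall A : set T, measurable A <-> <<s open >> (f @` A)].

Definition nonatomic d (T : measurableType d) (R : realType)
    (mu : probability T R) : Prop :=
  forall A : set T, measurable A -> (0 < mu A)%E ->
    exists B : set T,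
      [/\ measurable B, B `<=` A, (0 < mu B)%E & (mu B < mu A)%E].

(* These are representatives of the elements of A(G, T, mu): actions that
   agree almost everywhere are not equal here, but weak equivalence, and hence
   everything stated below, does not distinguish them.  As G is discrete, an
   action is Borel when every group element acts by a Borel map. *)
Record mpaction (G : groupType) d (T : measurableType d) (R : realType)
    (mu : probability T R) := Mpaction {
  act :> G -> T -> T ;
  act1 : forall x, act 1%g x = x ;
  actM : forall g h x, act (g * h)%g x = act g (act h x) ;
  measurable_act : forall g, measurable_fun [set: T] (act g) ;
  act_preserves : forall g (A : set T), measurable A ->
    mu (act g @^-1` A) = mu A }.

Arguments mpaction G {d T R} mu.

Definition weakly_contained (R : realType) (G : groupType)
    d1 (T1 : measurableType d1) (mu1 : probability T1 R)
    d2 (T2 : measurableType d2) (mu2 : probability T2 R)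
    (a : mpaction G mu1) (b : mpaction G mu2) : Prop :=
  forall (n : nat) (A : 'I_n -> set T1) (F : set G) (e : R),
    (forall i, measurable (A i)) -> finite_set F -> 0 < e ->
    exists B : 'I_n -> set T2,
      (forall i, measurable (B i)) /\
      forall g, F g -> forall i j : 'I_n,
        (`| mu1 ((a g @` A i) `&` A j) - mu2 ((b g @` B i) `&` B j) |
           < e%:E)%E.

Definition weakly_equivalent (R : realType) (G : groupType)
    d1 (T1 : measurableType d1) (mu1 : probability T1 R)
    d2 (T2 : measurableType d2) (mu2 : probability T2 R)
    (a : mpaction G mu1) (b : mpaction G mu2) : Prop :=
  weakly_contained a b /\ weakly_contained b a.

(* Isomorphism modulo null sets; for measure-preserving f and g inverse to each
   other, b is the transport of a along f. *)
Definition isomorphic (R : realType) (G : groupType)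
    d1 (T1 : measurableType d1) (mu1 : probability T1 R)
    d2 (T2 : measurableType d2) (mu2 : probability T2 R)
    (a : mpaction G mu1) (b : mpaction G mu2) : Prop :=
  exists (f : {mfun T1 >-> T2}) (g : {mfun T2 >-> T1}),
    [/\ (forall A, measurable A -> mu1 (f @^-1` A) = mu2 A),
        {ae mu1, forall x, g (f x) = x},
        {ae mu2, forall y, f (g y) = y}
      & forall h, {ae mu1, forall x, f (a h x) = b h (f x)}].

(* The disjoint union of two copies of T is T * bool, the copy labelled by true
   having measure t mu and the copy labelled by false (1 - t) mu.  This is
   meaningful only for 0 <= t <= 1: otherwise bernoulli_prob t is the Dirac mass
   at false. *)
Definition dsum_prob (R : realType) d (T : measurableType d)
    (mu : probability T R) (t : R) : probability (T * bool)%type R :=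
  (mu \x bernoulli_prob t)%E.

Definition dsum_act (R : realType) (G : groupType) d (T : measurableType d)
    (mu : probability T R) (a b : mpaction G mu) (g : G) (p : T * bool) :
    T * bool :=
  (if p.2 then a g p.1 else b g p.1, p.2).

Lemma dsum_act1 (R : realType) (G : groupType) d (T : measurableType d)
    (mu : probability T R) (a b : mpaction G mu) p :
  dsum_act a b 1%g p = p.
Proof. by case: p => x []; rewrite /dsum_act/= act1. Qed.

Lemma dsum_actM (R : realType) (G : groupType) d (T : measurableType d)
    (mu : probability T R) (a b : mpaction G mu) g h p :
  dsum_act a b (g * h)%g p = dsum_act a b g (dsum_act a b h p).
Proof. by case: p => x []; rewrite /dsum_act/= actM. Qed.

Lemma measurable_dsum_act (R : realType) (G : groupType) d
    (T : measurableType d) (mu : probability T R) (a b : mpaction G mu) g :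
  measurable_fun [set: T * bool] (dsum_act a b g).
Proof.
apply/measurable_fun_pairP; split; last exact: measurable_snd.
apply: measurable_fun_ifT; first exact: measurable_snd.
- by apply: measurableT_comp; [exact: measurable_act|exact: measurable_fst].
- by apply: measurableT_comp; [exact: measurable_act|exact: measurable_fst].
Qed.

Lemma dsum_act_preserves (R : realType) (G : groupType) d
    (T : measurableType d) (mu : probability T R) (t : R) (a b : mpaction G mu)
    g (A : set (T * bool)) : measurable A ->
  dsum_prob mu t (dsum_act a b g @^-1` A) = dsum_prob mu t A.
Proof.
move=> mA.
have mgA : measurable (dsum_act a b g @^-1` A).
  by rewrite -[X in measurable X]setTI; exact: measurable_dsum_act.
have E B : measurable B -> dsum_prob mu t B = (mu \x^ bernoulli_prob t)%E B.
  apply: product_measure_unique => A1 A2 mA1 mA2.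
  exact: product_measure2E.
rewrite !E//; apply: eq_integral => y _ /=.
rewrite -[in RHS](act_preserves (if y then a else b) g); last first.
  exact: measurable_ysection.
by congr (mu _); apply/seteqP; split => x /=;
  rewrite !ysectionE/= /dsum_act/=; case: y.
Qed.

Definition dsum (R : realType) (G : groupType) d (T : measurableType d)
    (mu : probability T R) (t : R) (a b : mpaction G mu) :
    mpaction G (dsum_prob mu t) :=
  Mpaction (dsum_act1 a b) (dsum_actM a b) (measurable_dsum_act a b)
    (dsum_act_preserves t a b).

Definition weq_class (R : realType) (G : groupType) d (T : measurableType d)
    (mu : probability T R) (a : mpaction G mu) : set (mpaction G mu) :=
  [set b | weakly_equivalent a b].

(* The quotient of A(G, T, mu) by weak equivalence. *)
Definition Asim (R : realType) (G : groupType) d (T : measurableType d)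
    (mu : probability T R) : set (set (mpaction G mu)) :=
  range (@weq_class R G d T mu).

Arguments Asim {R} G {d T} mu.

(* t x + (1 - t) y, as the set of all actions weakly equivalent to a transport
   to (T, mu) of the disjoint sum of representatives of x and y. *)
Definition convex_comb (R : realType) (G : groupType) d (T : measurableType d)
    (mu : probability T R) (t : R) (x y : set (mpaction G mu)) :
    set (mpaction G mu) :=
  [set c | exists a b c' : mpaction G mu,
    [/\ x a, y b, isomorphic (dsum t a b) c' & weakly_equivalent c' c]].

Definition extreme_point (R : realType) (G : groupType) d
    (T : measurableType d) (mu : probability T R)
    (x : set (mpaction G mu)) : Prop :=
  Asim G mu x /\
  forall (t : R) (y z : set (mpaction G mu)), 0 < t < 1 ->
    Asim G mu y -> Asim G mu z -> x = convex_comb t y z -> y = x /\ z = x.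

Definition ergodic (R : realType) (G : groupType) d (T : measurableType d)
    (mu : probability T R) (a : mpaction G mu) : Prop :=
  forall A : set T, measurable A -> (forall g, a g @^-1` A = A) ->
    mu A = 0%E \/ mu A = 1%E.

(* a = \int_Z a_z deta(z): pi is the factor map onto (Z, eta) with the trivial
   action, z |-> mu_ z is the disintegration of mu over eta.  The fiber
   (pi^-1(z), mu_z) is represented by (X, mu_ z), of which it is a subset of full
   measure, so a_ z is an action on (X, mu_ z) that agrees a.e. with a; this
   determines a_ z as an element of A(G, X, mu_ z).  For the z in an eta-null
   set, a_ z is arbitrary. *)
Record ergodic_decomposition (R : realType) (G : groupType)
    d (X : measurableType d) (mu : probability X R) (a : mpaction G mu)
    dZ (Z : measurableType dZ) (eta : probability Z R) (pi : X -> Z)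
    (mu_ : Z -> pprobability X R) (a_ : forall z, mpaction G (mu_ z)) :
    Prop := {
  edec_measurable : measurable_fun [set: X] pi ;
  edec_pushforward : forall B : set Z, measurable B ->
    mu (pi @^-1` B) = eta B ;
  edec_invariant : forall g, {ae mu, forall x, pi (a g x) = pi x} ;
  edec_kernel : measurable_fun [set: Z] mu_ ;
  edec_disintegration : forall A : set X, measurable A ->
    mu A = (\int[eta]_z mu_ z A)%E ;
  edec_fiber : {ae eta, forall z, mu_ z (pi @^-1` [set z]) = 1%E} ;
  edec_restriction : {ae eta, forall z, forall g,
    {ae mu_ z, forall x, a_ z g x = a g x}} ;
  edec_ergodic : {ae eta, forall z, ergodic (a_ z)} }.

(* Main.v *)
Require Import Defs.
From HB Require Import structures.
From mathcomp Require Import all_boot all_order all_algebra.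
From mathcomp Require Import all_classical all_reals all_analysis.
From mathcomp Require Import unstable measurable_realfun random_variable.
From mathcomp Require Import ring lra.

Set Implicit Arguments.
Unset Strict Implicit.
Unset Printing Implicit Defensive.

Import Order.TTheory GRing.Theory Num.Theory.
Import numFieldNormedType.Exports.

Local Open Scope classical_set_scope.
Local Open Scope ring_scope.

(** Weak containment of one action in another is a countable list of
   conditions: approximate the given sets by members of a countable dense
   family and round their correlations to fractions ([pattern],
   [weakly_contained_patterns]).  For each pattern, the fibres [a_ z] that show
   it form a measurable set [W] of indices, and only patterns for which [W] has
   positive measure matter.  The claim is that each of these patterns shows, up
   to a change of rounding, in almost every fibre; then any two fibres outside
   a null set are weakly contained in each other, and [b] can be taken to be
   one of them.

   The claim is proved in two steps.  The first goes from the fibres over [W]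
   to [a].  The restriction of [a] to the preimage [E] of [W], with normalised
   measure, shows the pattern, because its correlations are averages of those
   of the fibres over [W].  If [E] does not have full measure, then [a] is a
   proper convex combination of its restrictions to [E] and to the complement
   of [E], so by extremality it is weakly equivalent to both
   ([extreme_restriction]).  Hence [a] shows the pattern too.  To see the
   restrictions as actions on [(X, mu)] one needs the isomorphism of atomless
   standard probability spaces ([nonatomic_isomorphism]).  It is obtained from
   a Borel embedding of [X] into the line with Borel left inverse, and on the
   line from distribution functions and quantiles.

   As this applies to all patterns of positive measure, almost every fibre is
   weakly contained in [a].  The second step goes back from [a] to almost every
   fibre ([ergodic_fibers]).  Let [e] be an ergodic action that is weakly
   contained in [a].  By the mean ergodic theorem ([mean_ergodic]), suitable
   averages of translates of the indicator of a set are close in L2 to the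
   constant that is the measure of the set.  This closeness is a statement
   about measures of pairwise intersections, so it passes to the approximating
   sets in [a].  Averaging over translates does not change the mean on an
   invariant fibre, so these sets have nearly the same measure in most fibres.
   Applied to the intersections whose measures are the correlations of [e],
   this shows that almost every fibre has the correlations of [e].  The fibres
   [a_ z] that show a given pattern are themselves ergodic and, by the first
   step, weakly contained in [a]; one of them serves as [e]. *)

(** * Countable families, and weak containment in terms of finite families *)

Lemma countable_enum (T : Type) (D : set T) (x0 : T) : countable D ->
  exists s : nat -> T, forall x, D x -> exists n, s n = x.
Proof.
move=> /countable_injP[f finj].
pose s n := if pselect (exists x, D x /\ f x = n) is left h
  then sval (cid h) else x0.
exists s => x Dx; exists (f x); rewrite /s.
case: pselect => [h|[]]; last by exists x.
by case: cid => y /= [Dy fyx]; apply: finj; rewrite ?inE.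
Qed.

Lemma ae_forall_countable (R : realType) d (T : measurableType d)
    (mu : {measure set T -> \bar R}) (I : Type) (P : I -> T -> Prop) :
  countable [set: I] -> (forall i, {ae mu, forall x, P i x}) ->
  {ae mu, forall x, forall i, P i x}.
Proof.
move=> cI aeP; have [[i0]|noI] := pselect (inhabited I); last first.
  by apply: aeW => x i; case: noI.
have [s sI] := countable_enum i0 cI.
apply: filterS (ae_foralln (fun n => aeP (s n))) => x Ps i.
by have [n <-] := sI i Logic.I; exact: Ps.
Qed.

Lemma measurable_forall_countable d (T : measurableType d) (I : Type)
    (P : I -> set T) : countable [set: I] -> (forall i, measurable (P i)) ->
  measurable [set x | forall i, P i x].
Proof.
move=> cI mP; have [[i0]|noI] := pselect (inhabited I); last first.
  rewrite [X in measurable X](_ : _ = setT)//.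
  by apply/seteqP; split => // x _ i; case: noI.
have [s sI] := countable_enum i0 cI.
rewrite [X in measurable X](_ : _ = \bigcap_n P (s n)).
  by apply: bigcap_measurableType => n _; exact: mP.
apply/seteqP; split => x Px; first by move=> n _; exact: Px.
by move=> i; have [n <-] := sI i Logic.I; exact: Px.
Qed.

Lemma measurable_fun_ge (R : realType) d (T : measurableType d) (f : T -> R)
    (c : R) : measurable_fun setT f -> measurable [set x | c <= f x].
Proof.
move=> mf; rewrite [X in measurable X](_ : _ = f @^-1` `[c, +oo[).
  by rewrite -[X in measurable X]setTI; exact: (mf measurableT).
by apply/seteqP; split => x /=; rewrite in_itv/= andbT.
Qed.

Lemma measurable_fun_le (R : realType) d (T : measurableType d) (f : T -> R)
    (c : R) : measurable_fun setT f -> measurable [set x | f x <= c].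
Proof.
move=> mf; rewrite [X in measurable X](_ : _ = f @^-1` `]-oo, c]).
  by rewrite -[X in measurable X]setTI; exact: (mf measurableT).
by apply/seteqP; split => x /=; rewrite in_itv.
Qed.

Section corr.
Context (R : realType) (G : groupType).

Section one.
Context d (T : measurableType d) (mu : probability T R) (a : mpaction G mu).

Lemma actK g : cancel (a g) (a g^-1%g).
Proof. by move=> x; rewrite -actM mulVg act1. Qed.

Lemma actVK g : cancel (a g^-1%g) (a g).
Proof. by move=> x; rewrite -actM mulgV act1. Qed.

Lemma act_imageE g A : a g @` A = a g^-1%g @^-1` A.
Proof.
apply/seteqP; split => [_ [x Ax <-]|x /= Ax]; first by rewrite /= actK.
by exists (a g^-1%g x) => //; rewrite actVK.
Qed.

Lemma measurable_act_preimage g A :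
  measurable A -> measurable (a g @^-1` A).
Proof.
by move=> mA; rewrite -[X in measurable X]setTI; exact: measurable_act.
Qed.

Lemma measurable_act_image g A : measurable A -> measurable (a g @` A).
Proof. by rewrite act_imageE; exact: measurable_act_preimage. Qed.

Lemma act_image_preserves g A : measurable A -> mu (a g @` A) = mu A.
Proof. by move=> mA; rewrite act_imageE act_preserves. Qed.

End one.

Definition corr d (T : measurableType d) (mu : probability T R)
  (a : mpaction G mu) g (A B : set T) : R := fine (mu ((a g @` A) `&` B)).

Lemma corrE d (T : measurableType d) (mu : probability T R)
  (a : mpaction G mu) g (A B : set T) : measurable A -> measurable B ->
  mu ((a g @` A) `&` B) = (corr a g A B)%:E.
Proof.
move=> mA mB; rewrite fineK// fin_num_measure//.
by apply: measurableI => //; exact: measurable_act_image.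
Qed.

Section two.
Context d1 (T1 : measurableType d1) (mu1 : probability T1 R)
  d2 (T2 : measurableType d2) (mu2 : probability T2 R)
  (a : mpaction G mu1) (b : mpaction G mu2).

(** Families indexed by a finite type spare the reindexing by ordinals when
   several families of sets are approximated at once. *)
Lemma weakly_containedP : weakly_contained a b <->
  forall (I : finType) (A : I -> set T1) (F : set G) (e : R),
    (forall i, measurable (A i)) -> finite_set F -> 0 < e ->
    exists B : I -> set T2, (forall i, measurable (B i)) /\
      forall g, F g -> forall i j,
        `|corr a g (A i) (A j) - corr b g (B i) (B j)| < e.
Proof.
split=> [ab I A F e mA finF e0|ab n A F e mA finF e0].
- have [//|B [mB AB]] := ab _ (fun k : 'I_#|I| => A (enum_val k)) F e _ finF e0.
  exists (fun i => B (enum_rank i)); split => // g Fg i j.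
  have := AB g Fg (enum_rank i) (enum_rank j); rewrite !enum_rankK.
  by rewrite !corrE.
- have [B [mB AB]] := ab _ A F e mA finF e0.
  exists B; split => // g Fg i j.
  by rewrite !corrE//; exact: AB.
Qed.

End two.

End corr.

Section weak_containment.
Context (R : realType) (G : groupType).

Lemma weakly_contained_trans d1 (T1 : measurableType d1) (mu1 : probability T1 R)
  d2 (T2 : measurableType d2) (mu2 : probability T2 R)
  d3 (T3 : measurableType d3) (mu3 : probability T3 R)
  (a : mpaction G mu1) (b : mpaction G mu2) (c : mpaction G mu3) :
  weakly_contained a b -> weakly_contained b c -> weakly_contained a c.
Proof.
move=> /weakly_containedP ab /weakly_containedP bc.
apply/weakly_containedP => I A F e mA finF e0.
have e20 : 0 < e / 2 by rewrite divr_gt0.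
have [B [mB AB]] := ab I A F (e / 2) mA finF e20.
have [C [mC BC]] := bc I B F (e / 2) mB finF e20.
exists C; split => // g Fg i j; rewrite [ltRHS]splitr.
rewrite (le_lt_trans (ler_distD (corr b g (B i) (B j)) _ _))//.
by rewrite ltrD// ?AB ?BC.
Qed.

Lemma weakly_equivalent_sym d1 (T1 : measurableType d1) (mu1 : probability T1 R)
  d2 (T2 : measurableType d2) (mu2 : probability T2 R)
  (a : mpaction G mu1) (b : mpaction G mu2) :
  weakly_equivalent a b -> weakly_equivalent b a.
Proof. by case. Qed.

Lemma weakly_equivalent_refl d1 (T1 : measurableType d1)
  (mu1 : probability T1 R) (a : mpaction G mu1) : weakly_equivalent a a.
Proof.
have aa : weakly_contained a a.
  apply/weakly_containedP => I A F e mA finF e0.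
  by exists A; split => // g Fg i j; rewrite subrr normr0.
by split.
Qed.

Lemma weakly_equivalent_trans d1 (T1 : measurableType d1)
  (mu1 : probability T1 R) d2 (T2 : measurableType d2) (mu2 : probability T2 R)
  d3 (T3 : measurableType d3) (mu3 : probability T3 R)
  (a : mpaction G mu1) (b : mpaction G mu2) (c : mpaction G mu3) :
  weakly_equivalent a b -> weakly_equivalent b c -> weakly_equivalent a c.
Proof.
move=> [ab ba] [bc cb]; split; first exact: weakly_contained_trans ab bc.
exact: weakly_contained_trans cb ba.
Qed.

End weak_containment.

Lemma ae_eq_set_measure (R : realType) d (T : measurableType d)
    (mu : {measure set T -> \bar R}) (A B : set T) :
  measurable A -> measurable B -> {ae mu, forall x, A x <-> B x} ->
  mu A = mu B.
Proof.
move=> mA mB [N [mN N0 sub]].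
have le C D : measurable C -> measurable D -> C `<=` D `|` N ->
    (mu C <= mu D)%E.
  move=> mC mD CD; apply: (@le_trans _ _ (mu (D `|` N))).
    by apply: le_measure; rewrite ?inE//; exact: measurableU.
  by rewrite (le_trans (measureU2 mu mD mN))// [X in (_ + X)%E]N0 adde0.
have mem x : N x \/ (A x <-> B x).
  by have [Nx|nNx] := pselect (N x); [left|right; apply: contrapT => /sub].
apply/eqP; rewrite eq_le; apply/andP; split; apply: le => // x ?.
- by have [|[AB _]] := mem x; [right|left; exact: AB].
- by have [|[_ BA]] := mem x; [right|left; exact: BA].
Qed.

Section iso_weq.
Context (R : realType) (G : groupType).

Lemma isomorphic_weakly_equivalent d1 (T1 : measurableType d1)
  (mu1 : probability T1 R) d2 (T2 : measurableType d2) (mu2 : probability T2 R)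
  (a : mpaction G mu1) (b : mpaction G mu2) :
  isomorphic a b -> weakly_equivalent a b.
Proof.
move=> [f [g [fmu gf fg fab]]].
have mf A : measurable A -> measurable (f @^-1` A).
  exact: measurable_funPTI.
have mg A : measurable A -> measurable (g @^-1` A).
  exact: measurable_funPTI.
have H h A B : measurable A -> measurable B ->
    mu1 ((a h @` (f @^-1` A)) `&` f @^-1` B) = mu2 ((b h @` A) `&` B).
  move=> mA mB; rewrite -fmu; last first.
    by apply: measurableI => //; exact: measurable_act_image.
  apply: ae_eq_set_measure.
  - by apply: measurableI; [apply: measurable_act_image|]; exact: mf.
  - by apply: mf; apply: measurableI => //; exact: measurable_act_image.
  - apply: filterS (fab h^-1%g) => x fx.
    by rewrite !act_imageE/= fx.
have H2 h A B : measurable A -> measurable B ->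
    mu2 ((b h @` (g @^-1` A)) `&` g @^-1` B) = mu1 ((a h @` A) `&` B).
  move=> mA mB; rewrite -H; [|exact: mg|exact: mg].
  have [mgA mgB] := (mf _ (mg _ mA), mf _ (mg _ mB)).
  have E C : measurable C -> mu1 ((C `\` f @^-1` (g @^-1` C)) `|`
      (f @^-1` (g @^-1` C) `\` C)) = 0%E.
    move=> mC; rewrite -(measure0 mu1); apply: ae_eq_set_measure => //.
      by apply: measurableU; apply: measurableD => //; exact/mf/mg.
    apply: filterS gf => x gfx; split=> //.
    by rewrite /setU/setD/= gfx => -[] [].
  apply: ae_eq_set_measure.
  - by apply: measurableI => //; exact: measurable_act_image.
  - by apply: measurableI => //; exact: measurable_act_image.
  - rewrite !act_imageE.
    have K : {ae mu1, forall x, A (g (f (a h^-1%g x))) <-> A (a h^-1%g x)}.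
      pose D := (A `\` f @^-1` (g @^-1` A)) `|` (f @^-1` (g @^-1` A) `\` A).
      exists (a h^-1%g @^-1` D).
      have mD : measurable D.
        by apply: measurableU; apply: measurableD => //; exact/mf/mg.
      split; first exact: measurable_act_preimage.
        by rewrite /= act_preserves//; exact: E.
      move=> x /= nA; apply: contrapT => nD; apply: nA; split => ?;
        apply: contrapT => ?; apply: nD; [by right|by left].
    apply: filterS2 gf K => x gfx K /=; rewrite gfx.
    by split => -[? ?]; split => //; apply/K.
split; apply/weakly_containedP => I A F e mA finF e0.
- exists (fun i => g @^-1` A i); split; first by move=> i; exact: mg.
  by move=> h Fh i j; rewrite /corr H2// subrr normr0.
- exists (fun i => f @^-1` A i); split; first by move=> i; exact: mf.
  by move=> h Fh i j; rewrite /corr H// subrr normr0.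
Qed.

End iso_weq.

Section dsum.
Context (R : realType) (G : groupType).

Lemma dsum_probE d (T : measurableType d) (mu : probability T R) (t : R)
    (A : set (T * bool)) : 0 <= t <= 1 -> measurable A ->
  dsum_prob mu t A = (t%:E * mu (ysection A true) +
    (1 - t)%:E * mu (ysection A false))%E.
Proof.
move=> t01 mA.
transitivity ((mu \x^ bernoulli_prob t)%E A).
  apply: product_measure_unique => // A1 A2 mA1 mA2.
  exact: product_measure2E.
by rewrite /product_measure2/= integral_bernoulli_prob.
Qed.

Lemma dsum_corrE d (T : measurableType d) (mu : probability T R) (t : R)
    (a b : mpaction G mu) g (A B : set (T * bool)) :
  0 <= t <= 1 -> measurable A -> measurable B ->
  corr (dsum t a b) g A B =
  t * corr a g (ysection A true) (ysection B true) +
  (1 - t) * corr b g (ysection A false) (ysection B false).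
Proof.
move=> t01 mA mB; apply: EFin_inj; rewrite -corrE//.
rewrite dsum_probE//; last first.
  by apply: measurableI => //; exact: measurable_act_image.
rewrite [in RHS]EFinD !EFinM -!corrE; [|exact: measurable_ysection..].
congr (_ * mu _ + _ * mu _)%E; rewrite !act_imageE; apply/seteqP;
  by split => x /=; rewrite !ysectionE/= /dsum_act/=.
Qed.

(** The two copies are approximated separately, because a correlation of the
   sum is the average of the correlations on the copies. *)
Lemma dsum_weakly_contained d (T : measurableType d) (mu : probability T R)
    (t : R) (a b a' b' : mpaction G mu) : 0 <= t <= 1 ->
  weakly_contained a a' -> weakly_contained b b' ->
  weakly_contained (dsum t a b) (dsum t a' b').
Proof.
move=> t01 /weakly_containedP aa' /weakly_containedP bb'.
have /andP[t0 t1] := t01.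
apply/weakly_containedP => I A F e mA finF e0.
have mys s i : measurable (ysection (A i) s) by exact: measurable_ysection.
have [B [mB AB]] := aa' I _ F e (mys true) finF e0.
have [C [mC AC]] := bb' I _ F e (mys false) finF e0.
pose D i := (B i `*` [set true]) `|` (C i `*` [set false]).
have mD i : measurable (D i).
  by apply: measurableU; exact: measurableX.
have DB i : ysection (D i) true = B i.
  by apply/seteqP; split => x; rewrite ysectionE/= /D/=; tauto || (by case=> -[]) || (by left).
have DC i : ysection (D i) false = C i.
  by apply/seteqP; split => x; rewrite ysectionE/= /D/=; tauto || (by case=> -[]) || (by right).
exists D; split => // g Fg i j; rewrite !dsum_corrE// !DB !DC.
rewrite opprD addrACA -!mulrBr (le_lt_trans (ler_normD _ _))//.
rewrite !normrM (ger0_norm t0) (@ger0_norm _ (1 - t)) ?subr_ge0//.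
have := AB g Fg i j; have := AC g Fg i j.
set u := `|_| => ue; set v := `|_| => ve.
apply: (@le_lt_trans _ _ (Num.max u v)); last by rewrite gt_max ue.
rewrite -[leRHS](_ : t * Num.max u v + (1 - t) * Num.max u v = _); last first.
  by rewrite -mulrDl subrKC mul1r.
by rewrite lerD// ler_wpM2l ?subr_ge0// le_max lexx ?orbT.
Qed.

Lemma dsum_weakly_equivalent d (T : measurableType d) (mu : probability T R)
    (t : R) (a b a' b' : mpaction G mu) : 0 <= t <= 1 ->
  weakly_equivalent a a' -> weakly_equivalent b b' ->
  weakly_equivalent (dsum t a b) (dsum t a' b').
Proof.
by move=> t01 [? ?] [? ?]; split; exact: dsum_weakly_contained.
Qed.

End dsum.

(** * Embedding a standard Borel space into the line *)

Section ternary.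
Context {R : realType}.

(** Partial sums of [2 * s 0 / 3 + 2 * s 1 / 9 + ...].  Digits 0 and 2 leave the
   middle thirds free, so that they can be read off the sum by Borel maps. *)
Fixpoint ternary_trunc n (s : nat -> bool) : R :=
  if n is m.+1 then (2 * (s 0)%:R + ternary_trunc m (fun k => s k.+1)) / 3
  else 0.

Definition ternary (s : nat -> bool) : R :=
  limn (fun n => ternary_trunc n s).

(** The shift of the Cantor set, extended to the line. *)
Fixpoint ternary_shift n (y : R) : R :=
  if n is m.+1 then
    3 * ternary_shift m y - (if 1/2 <= ternary_shift m y then 2 else 0)
  else y.

Definition ternary_digit n (y : R) : bool := 1/2 <= ternary_shift n y.

Lemma ternary_trunc_itv n s : 0 <= ternary_trunc n s <= 1.
Proof.
elim: n s => [s|n ih s] /=; first by rewrite lexx ler01.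
by have := ih (fun k => s k.+1); case: (s 0) => /=; lra.
Qed.

Lemma ternary_trunc_nd s :
  {homo (fun n => ternary_trunc n s) : n m / (n <= m)%N >-> n <= m}.
Proof.
apply/nondecreasing_seqP => n; elim: n s => [s|n ih s].
  by case/andP: (ternary_trunc_itv 1 s).
by have /= := ih (fun k => s k.+1); lra.
Qed.

Lemma ternary_trunc_is_cvg s : cvgn (fun n => ternary_trunc n s).
Proof.
apply: nondecreasing_is_cvgn; first exact: ternary_trunc_nd.
by exists 1 => _ [n _ <-]; case/andP: (ternary_trunc_itv n s).
Qed.

Lemma ternary_itv s : 0 <= ternary s <= 1.
Proof.
by apply/andP; split; [apply: limr_ge|apply: limr_le];
  try exact: ternary_trunc_is_cvg; apply: nearW => n;
  case/andP: (ternary_trunc_itv n s).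
Qed.

Lemma ternary_rec s :
  ternary s = (2 * (s 0)%:R + ternary (fun k => s k.+1)) / 3.
Proof.
apply: (@cvg_unique R _ (ternary_trunc n.+1 s @[n --> \oo])).
- exact: norm_hausdorff.
- have := @ternary_trunc_is_cvg s : (fun n => ternary_trunc n s) @ \oo --> ternary s.
  rewrite -cvg_shiftS. exact.
- apply: cvgMl; apply: cvgD; first exact: cvg_cst.
  exact: ternary_trunc_is_cvg.
Qed.

Lemma ternary_shiftK n s :
  ternary_shift n (ternary s) = ternary (fun k => s (n + k)%N).
Proof.
elim: n => [//|n ih] /=; rewrite ih.
have := ternary_rec (fun k => s (n + k)%N); rewrite addn0.
rewrite (_ : (fun k => s (n + k.+1)%N) = fun k => s (n.+1 + k)%N); last first.
  by apply/funext => k; rewrite addnS.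
have := ternary_itv (fun k => s (n.+1 + k)%N).
set t := ternary _; set u := ternary _.
by case: ifPn => h; case: (s n) => /= *; lra.
Qed.

Lemma ternaryK s n : ternary_digit n (ternary s) = s n.
Proof.
rewrite /ternary_digit ternary_shiftK ternary_rec addn0.
have := ternary_itv (fun k => s (n + k.+1)%N).
by case: (s n) => /= *; [apply/idP|apply/negbTE; rewrite -ltNge]; lra.
Qed.

Lemma measurable_ternary_shift n : measurable_fun setT (ternary_shift n).
Proof.
elim: n => [|n ih] /=; first exact: measurable_id.
apply: measurable_funB; first exact: measurable_funM.
apply: measurable_fun_ifT => //.
by apply: measurable_fun_ler => //; exact: measurable_cst.
Qed.

Lemma measurable_ternary_digit n : measurable (ternary_digit n : set R).
Proof.
have := @measurable_fun_ler _ _ _ _ (cst (1/2)) _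
  (measurable_cst _) (measurable_ternary_shift n).
move=> /(_ measurableT [set true]); rewrite setTI.
rewrite (_ : _ @^-1` _ = ternary_digit n); first exact.
by apply/seteqP; split => y.
Qed.

Lemma measurable_ternary d (T : measurableType d) (A : nat -> set T) :
  (forall k, measurable (A k)) ->
  measurable_fun setT (fun x => ternary (fun k => x \in A k)).
Proof.
move=> mA.
apply: (@measurable_fun_cvg _ _ _ _
  (fun n x => ternary_trunc n (fun k => x \in A k))).
  move=> n; elim: n A mA => [|n ih] A mA /=; first exact: measurable_cst.
  apply: measurable_funM => //; apply: measurable_funD.
    apply: measurable_funM => //.
    exact: (@measurable_indic _ _ R setT (A 0%N)).
  exact: (ih (fun k => A k.+1)).
by move=> x _; exact: ternary_trunc_is_cvg.
Qed.

End ternary.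

Section polish.
Context {R : realType} {P : completePseudoMetricType R}.
Variables (D : set P) (s : nat -> P).
Hypotheses (denseD : dense D) (sD : forall x, D x -> exists n, s n = x).
Hypothesis hausP : hausdorff_space P.

Let rad (m : nat) : R := m.+1%:R^-1.

Let rad_gt0 m : 0 < rad m. Proof. by rewrite invr_gt0. Qed.

Let rad_lt (e : R) : 0 < e -> exists m, rad m < e.
Proof.
move=> e0; exists (Num.truncn e^-1).
by rewrite /rad -[ltRHS]invrK ltf_pV2 ?posrE ?invr_gt0// truncnS_gt.
Qed.

Let rad_le m n : (m <= n)%N -> rad n <= rad m.
Proof. by move=> mn; rewrite lef_pV2 ?posrE// ler_nat. Qed.

(** The index of a basic open set also records a radius, so that a point can
   be located at every prescribed scale from its code alone. *)
Definition basis (k : nat) : set P :=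
  if (unpickle k : option (nat * nat)) is Some (n, m) then (ball (s n) (rad m))° else set0.

Lemma open_basis k : open (basis k).
Proof.
by rewrite /basis; case: unpickle => [[n m]|]; [exact: open_interior|exact: open0].
Qed.

Lemma basis_cover (j : nat) x : exists n : nat, basis (pickle (n, j)) x.
Proof.
have [||y [xy Dy]] := @denseD (ball x (rad j / 2))°.
- by exists x; apply/nbhsx_ballx; rewrite divr_gt0.
- exact: open_interior.
have [n sny] := sD Dy; exists n; rewrite /basis pickleK.
apply/nbhs_ballP; exists (rad j / 2) => /=; first by rewrite divr_gt0.
move=> z xz; rewrite sny [rad j]splitr; apply: ball_triangle xz.
by apply: ball_sym; exact: interior_subset xy.
Qed.

Definition center_idx (c : nat -> bool) (j : nat) : nat :=
  if pselect (exists n : nat, c (pickle (n, j))) is left h then ex_minn h else 0%N.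

Definition center (c : nat -> bool) (j : nat) : P := s (center_idx c j).

(** The centres chosen at two scales are as close as two balls with a common
   point force them to be; this makes the sequence of centres Cauchy. *)
Definition coherent (c : nat -> bool) : Prop :=
  forall i j, ball (center c i) (rad i + rad j) (center c j).

Definition decode (x0 : P) (c : nat -> bool) : P :=
  if pselect (coherent c) then lim (center c j @[j --> \oo]) else x0.

Let code x k := x \in basis k.

Lemma center_code x j : ball x (rad j) (center (code x) j).
Proof.
rewrite /center /center_idx; case: pselect => [h|]; last first.
  by have [n nx] := basis_cover j x; case; exists n; rewrite /code inE.
case: ex_minnP => n; rewrite /code inE /basis pickleK => + _.
by move=> /interior_subset; exact: ball_sym.
Qed.

Lemma coherent_cvg c : coherent c -> cvg (center c j @[j --> \oo]).
Proof.
move=> coh; apply/cauchy_cvgP; apply/cauchy_ballP => e e0.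
have [m me] := rad_lt (divr_gt0 e0 (ltr0n R 2)).
exists (center c @` [set n | (m <= n)%N], center c @` [set n | (m <= n)%N]).
  by split; exists m => // n mn; exists n.
move=> [_ _] [/= [i mi <-] [j mj <-]] /=.
apply: le_ball (coh i j); rewrite [leRHS]splitr.
by apply: lerD; [exact: le_trans (rad_le mi) (ltW me)|
  exact: le_trans (rad_le mj) (ltW me)].
Qed.

Lemma coherent_code x : coherent (code x).
Proof.
move=> i j; apply: ball_triangle (center_code x j).
by apply: ball_sym; exact: center_code.
Qed.

Lemma codeK x0 x : decode x0 (code x) = x.
Proof.
rewrite /decode; case: pselect => [coh|/(_ (coherent_code x))//].
apply: (cvg_unique hausP (coherent_cvg coh)).
apply/cvg_ballP => e e0; have [m me] := rad_lt e0.
exists m => // j /= mj; apply: le_ball (center_code x j).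
by rewrite (le_trans (rad_le mj))// ltW.
Qed.

(** Whether the limit lies in an open set depends on countably many conditions
   on the centres; this is why decoding is a Borel map. *)
Lemma decode_openP x0 c O : coherent c -> open O ->
  O (decode x0 c) <-> exists m J, forall j, (J <= j)%N ->
    ball (center c j) (rad m) `<=` O.
Proof.
move=> coh oO; rewrite /decode; case: pselect => // coh'.
have /cvg_ballP lm := coherent_cvg coh'.
split=> [|[m [J mJ]]]; last first.
  have [N _ /(_ (maxn N J))NJ] := lm _ (rad_gt0 m).
  apply: (mJ (maxn N J)); first exact: leq_maxr.
  by apply: ball_sym; apply: NJ; rewrite /= leq_maxl.
move=> Ol; have /nbhs_ballP[e /= e0 eO] := open_nbhs_nbhs (conj oO Ol).
have [m me] := rad_lt (divr_gt0 e0 (ltr0n R 2)).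
have [N _ NJ] := lm _ (rad_gt0 m).
exists m, N => j Nj z jz; apply: eO.
apply: (@le_ball _ _ _ (rad m + rad m)).
  by rewrite [leRHS]splitr lerD// ltW.
exact: ball_triangle (NJ _ Nj) jz.
Qed.

Section measurable_decode.
Context d (Y : measurableType d) (c : Y -> nat -> bool).
Hypothesis mc : forall k, measurable [set y | c y k].

Lemma measurable_center_idx j n : measurable [set y | center_idx (c y) j = n].
Proof.
have mC k : measurable [set y | ~ c y k] by exact: measurableC (mc k).
have mhas : measurable [set y | exists m : nat, c y (pickle (m, j))].
  rewrite [X in measurable X](_ : _ = \bigcup_m [set y | c y (pickle (m : nat, j))]).
    by apply: bigcup_measurable => m _; exact: mc.
  by apply/seteqP; split=> y [m]; [exists m|move=> _ ?; exists m].
have -> : [set y | center_idx (c y) j = n] =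
  ([set y | c y (pickle (n, j))] `&`
     \bigcap_(m in [set m | (m < n)%N]) [set y | ~ c y (pickle (m, j))]) `|`
  (~` [set y | exists m : nat, c y (pickle (m, j))] `&` [set y | n = 0%N]).
  apply/seteqP; split => y; rewrite /= /center_idx; case: pselect => [h|h].
  - case: ex_minnP => m cm mmin mn; left; subst m; split => // m /= mn cm'.
    by have := mmin _ cm'; rewrite leqNgt mn.
  - by move=> <-; right.
  - move=> [[cn nmin]|[]//]; case: ex_minnP => m cm mmin.
    apply/eqP; rewrite eqn_leq mmin// leqNgt; apply/negP => mn.
    exact: nmin _ mn cm.
  - by move=> [[cn _]|[_ ->]//]; case: h; exists n.
apply: measurableU; apply: measurableI => //.
- by apply: bigcap_measurableType => m _; exact: mC.
- exact: measurableC.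
- by have [->|n0] := pselect (n = 0%N); [rewrite [X in measurable X](_ : _ = setT)//|
  rewrite [X in measurable X](_ : _ = set0)//]; apply/seteqP; split.
Qed.

Lemma measurable_center (Q : P -> Prop) j :
  measurable [set y | Q (center (c y) j)].
Proof.
rewrite [X in measurable X](_ : _ =
  \bigcup_(n in [set n | Q (s n)]) [set y | center_idx (c y) j = n]).
  by apply: bigcup_measurable => n _; exact: measurable_center_idx.
apply/seteqP; split=> y /=; first by move=> ?; exists (center_idx (c y) j).
by move=> [n /= Qn En]; rewrite /center En.
Qed.

Lemma measurable_coherent : measurable [set y | coherent (c y)].
Proof.
rewrite [X in measurable X](_ : _ = \bigcap_i \bigcap_j
  \bigcup_n ([set y | center_idx (c y) i = n] `&`
    [set y | ball (s n) (rad i + rad j) (center (c y) j)])).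
  apply: bigcap_measurableType => i _; apply: bigcap_measurableType => j _.
  apply: bigcup_measurable => n _; apply: measurableI.
    exact: measurable_center_idx.
  exact: measurable_center.
apply/seteqP; split=> y /= coh.
  by move=> i _ j _; exists (center_idx (c y) i) => //; split => //; exact: coh.
by move=> i j; have [n _ [/= <-]] := coh i I j I.
Qed.

Lemma measurable_decode x0 O : open O ->
  measurable [set y | O (decode x0 (c y))].
Proof.
move=> oO.
have -> : [set y | O (decode x0 (c y))] =
  ([set y | coherent (c y)] `&` \bigcup_m \bigcup_J
    \bigcap_(j in [set j | (J <= j)%N])
      [set y | ball (center (c y) j) (rad m) `<=` O]) `|`
  (~` [set y | coherent (c y)] `&` [set y | O x0]).
  apply/seteqP; split => y /=.
  - have [coh|ncoh] := pselect (coherent (c y)).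
      move=> /(decode_openP x0 coh oO)[m [J mJ]].
      by left; split => //; exists m => //; exists J.
    by rewrite /decode; case: pselect => [//|? /= Ox0]; right.
  - move=> [[coh [m _ [J _ mJ]]]|[ncoh]].
      by apply/(decode_openP x0 coh oO); exists m, J.
    by rewrite /decode; case: (pselect (coherent (c y))).
apply: measurableU; apply: measurableI.
- exact: measurable_coherent.
- apply: bigcup_measurable => m _; apply: bigcup_measurable => J _.
  apply: bigcap_measurableType => j _.
  exact: (measurable_center (fun p => ball p (rad m) `<=` O)).
- by apply: measurableC; exact: measurable_coherent.
- by have [Ox0|Ox0] := pselect (O x0); [rewrite [X in measurable X](_ : _ = setT)//|
  rewrite [X in measurable X](_ : _ = set0)//]; apply/seteqP; split.
Qed.

End measurable_decode.
End polish.

(** A point is determined by the basic open sets that contain it, hence by the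
   ternary expansion with these digits.  The left inverse is a limit of Borel
   maps with countably many values, and completeness provides this limit on the
   Borel set of coherent codes. *)
Lemma standard_borel_embedding (R : realType) d (X : measurableType d) (x0 : X) :
  standard_borel R X ->
  exists (phi : X -> R) (g : R -> X),
    [/\ measurable_fun setT phi, measurable_fun setT g & cancel phi g].
Proof.
move=> [P [f [hausP [D cD dD] [f' fK f'K] fm]]].
have [s sD] := countable_enum (f x0) cD.
pose A k := f @^-1` basis s k.
have mA k : measurable (A k).
  apply/fm; apply: sub_sigma_algebra.
  rewrite (_ : f @` A k = basis s k); first exact: open_basis.
  by rewrite image_preimage// -subTset => p _; exists (f' p).
exists (fun x => ternary (fun k => x \in A k)).
pose h (y : R) := decode s (f x0) (ternary_digit ^~ y).
exists (f' \o h); split.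
- exact: measurable_ternary.
- move=> _ B mB; rewrite setTI.
  have -> : (f' \o h) @^-1` B = h @^-1` (f @` B).
    apply/seteqP; split=> y /=; first by move=> Bh; exists (f' (h y)).
    by move=> [x Bx <-]; rewrite fK.
  have /fm : measurable B by [].
  apply: (smallest_sub (X := [set C | measurable (h @^-1` C)])).
    split => /=.
    + by rewrite preimage_set0.
    + by move=> C mC; rewrite setTD preimage_setC; exact: measurableC.
    + by move=> F mF; rewrite preimage_bigcup; exact: bigcup_measurable.
  move=> O oO; apply: measurable_decode => // k.
  exact: measurable_ternary_digit.
- move=> x /=; rewrite /h.
  rewrite (_ : (fun k => _) = fun k => f x \in basis s k).
    by rewrite (codeK dD).
  by apply/funext => k; rewrite ternaryK /A; apply/idP/idP; rewrite !inE.
Qed.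

(** * Isomorphism of atomless standard probability spaces *)

Lemma measure_eq_rays (R : realType) (m1 m2 : probability R R) :
  (forall r, m1 [set y | r < y] = m2 [set y | r < y]) ->
  forall A, measurable A -> m1 A = m2 A.
Proof.
move=> m12.
apply: (measure_unique (@RGenOInfty.G R) (fun k => `]- k%:R, +oo[%classic)).
- exact: RGenOInfty.measurableE.
- move=> _ _ [x ->] [y ->]; exists (Num.max x y).
  by apply/seteqP; split=> z /=; rewrite !in_itv/= !andbT gt_max => /andP.
- by move=> k; exists (- k%:R).
- rewrite -subTset => y _; exists (Num.bound y) => //=.
  by rewrite in_itv/= andbT ltrNl ltrNbound.
- move=> _ [r ->].
  have -> : [set` `]r, +oo[] = [set y | r < y].
    by apply/seteqP; split=> z /=; rewrite in_itv/= andbT.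
  exact: m12.
- by move=> k; rewrite (le_lt_trans (probability_le1 _ _))// ltry.
Qed.

Section cdf.
Context {R : realType} d (X : measurableType d) (phi : {mfun X >-> R}).

Section one.
Variable mu : probability X R.
Hypothesis atomless : forall y, mu [set x | phi x = y] = 0%E.

Lemma measurable_level (D : R -> Prop) : measurable (D : set R) ->
  measurable [set x | D (phi x)].
Proof. exact: measurable_funPTI. Qed.

Let mle r : measurable [set x | phi x <= r].
Proof. exact: measurable_fun_le. Qed.

Let mlt r : measurable [set x | phi x < r].
Proof.
apply: (measurable_level (D := fun y => y < r)).
rewrite (_ : (fun y => _) = `]-oo, r[%classic)//.
Qed.

Definition cdfr (r : R) : R := fine (mu [set x | phi x <= r]).

Lemma cdfrE r : mu [set x | phi x <= r] = (cdfr r)%:E.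
Proof. by rewrite fineK// fin_num_measure. Qed.

Let cdfr_cdf r : (cdfr r)%:E = cdf (phi : {RV mu >-> R}) r.
Proof.
rewrite -cdfrE /cdf/= /distribution/= /pushforward; congr (mu _).
Qed.

Lemma cdfr_nd (x y : R) : x <= y -> cdfr x <= cdfr y.
Proof. by move=> xy; rewrite -lee_fin !cdfr_cdf cdf_nondecreasing. Qed.

Lemma cdfr_itv r : 0 <= cdfr r <= 1.
Proof. by rewrite -!lee_fin !cdfr_cdf cdf_ge0 cdf_le1. Qed.

Definition quantile (u : R) : R := inf [set y | u <= cdfr y].

(** Right continuity of the distribution function makes the infimum that
   defines the quantile a minimum. *)
Lemma quantile_le (u y : R) : 0 < u < 1 -> (quantile u <= y) = (u <= cdfr y).
Proof.
move=> /andP[u0 u1].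
have S0 : [set y | u <= cdfr y] !=set0.
  have := @cvg_cdfy1 _ _ _ mu phi => /fine_cvgP[_].
  move=> /(@cvgr_ge _ _ _ _ _ _)/(_ _ u1)[M [_ MP]].
  by exists (M + 1) => /=; apply: MP; rewrite ltrDl.
have Slb : has_lbound [set y | u <= cdfr y].
  have := @cvg_cdfNy0 _ _ _ mu phi => /fine_cvgP[_].
  move=> /(@cvgr_lt _ _ _ _ _ _)/(_ _ u0)[M [_ MP]].
  exists M => z /= uz; rewrite leNgt; apply/negP => zM.
  by have := MP _ zM; rewrite /= ltNge; move/negP; apply.
have Q : u <= cdfr (quantile u).
  rewrite -lee_fin cdfr_cdf.
  apply: (@cvge_ge _ ((quantile u)^'+) _ _ (cdf (phi : {RV mu >-> R})));
    last exact: cdf_right_continuous.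
  near=> z; rewrite -cdfr_cdf lee_fin.
  have qz : quantile u < z by near: z; exact: nbhs_right_gt.
  have [e /= Se eu] := inf_lt S0 qz.
  by rewrite (le_trans Se)// cdfr_nd// ltW.
apply/idP/idP => [qy|uy]; last exact: ge_inf.
by rewrite (le_trans Q)// cdfr_nd.
Unshelve. all: by end_near. Qed.

Lemma measure_level_lt r : mu [set x | phi x < r] = (cdfr r)%:E.
Proof.
rewrite -cdfrE (_ : [set x | phi x <= r] =
  [set x | phi x < r] `|` [set x | phi x = r]).
  rewrite measureU//.
  - by apply/esym; rewrite -[RHS]adde0; congr (_ + _)%E; exact: atomless.
  - exact: (measurable_level (measurable_set1 r)).
  - by rewrite -subset0 => x [/= + xr]; rewrite xr ltxx.
apply/seteqP; split => x /=; rewrite le_eqVlt.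
  by case/orP => [/eqP|]; [right|left].
by case=> [->|->]; rewrite ?eqxx ?orbT.
Qed.

(** Without atoms the distribution function is continuous and skips no value. *)
Lemma quantileK u : 0 < u < 1 -> cdfr (quantile u) = u.
Proof.
move=> u01; apply/eqP; rewrite eq_le -[u <= _]quantile_le// lexx andbT.
rewrite -lee_fin -measure_level_lt.
set q := quantile u.
have -> : [set x | phi x < q] = \bigcup_n [set x | phi x <= q - n.+1%:R^-1].
  apply/seteqP; split => [x /= xq|x [n _ /=]].
    exists (Num.truncn (q - phi x)^-1) => //=.
    rewrite lerBrDr -lerBrDl -[leRHS]invrK lef_pV2 ?posrE ?invr_gt0 ?subr_gt0//.
    by rewrite ltW// truncnS_gt.
  by move=> /le_lt_trans; apply; rewrite ltrBlDr ltrDl invr_gt0.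
have cv : (mu \o (fun n => [set x | phi x <= q - n.+1%:R^-1])) x @[x --> \oo]
    --> mu (\bigcup_n [set x | phi x <= q - n.+1%:R^-1]).
  apply: nondecreasing_cvg_mu => //; first exact: bigcup_measurable.
  move=> m n mn; apply/subsetPset => x /= /le_trans; apply.
  by rewrite lerD2l lerN2 lef_pV2 ?posrE// ler_nat.
apply: (cvge_le _ cv); apply: nearW => n /=.
rewrite cdfrE lee_fin leNgt; apply/negP => /ltW; rewrite -quantile_le//.
by rewrite -/q leNgt ltrBlDr ltrDl invr_gt0 ltr0Sn.
Qed.

Let cdf_ltE u : 0 < u < 1 ->
  [set x | cdfr (phi x) < u] = [set x | phi x < quantile u].
Proof.
by move=> u01; apply/seteqP; split => x /=; rewrite !ltNge quantile_le.
Qed.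

Lemma measurable_cdfr : measurable_fun setT (cdfr \o phi).
Proof.
apply: measurableT_comp => //; apply: nondecreasing_measurable => //.
by move=> x y; exact: cdfr_nd.
Qed.

Let mcle u : measurable [set x | cdfr (phi x) <= u].
Proof. exact: (measurable_fun_le _ measurable_cdfr). Qed.

(** The probability integral transform: a sublevel set of the distribution
   function is a ray that ends at a quantile, whose measure is [quantileK]. *)
Lemma measure_cdfr_le u : 0 <= u <= 1 ->
  mu [set x | cdfr (phi x) <= u] = u%:E.
Proof.
move=> /andP[u0 u1].
have lt v : 0 < v < 1 -> mu [set x | cdfr (phi x) < v] = v%:E.
  by move=> v01; rewrite cdf_ltE// measure_level_lt quantileK.
have mclt v : 0 < v < 1 -> measurable [set x | cdfr (phi x) < v].
  by move=> v01; rewrite cdf_ltE.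
apply/eqP; rewrite eq_le; apply/andP; split; last first.
  apply/lee_subgt0Pr => e e0.
  have [|ue0] := leP (u - e) 0.
    by move=> ?; rewrite (le_trans _ (measure_ge0 _ _))// -EFinB lee_fin.
  have ue01 : 0 < u - e < 1 by rewrite ue0/=; lra.
  rewrite -EFinB -lt//; apply: le_measure; rewrite ?inE//; first exact: mclt.
  by move=> x /= /ltW/le_trans; apply; lra.
move: u1; rewrite [(u <= 1)%R]le_eqVlt => /orP[/eqP ->|u1]; first exact: probability_le1.
apply/lee_addgt0Pr => e e0.
pose v := Num.min (u + e) ((u + 1) / 2).
have v01 : 0 < v < 1 by rewrite /v lt_min gt_min; apply/andP; split;
  [apply/andP; split|apply/orP; right]; lra.
apply: (@le_trans _ _ v%:E); last by rewrite -EFinD lee_fin /v ge_min lexx.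
rewrite -lt//; apply: le_measure; rewrite ?inE//; first exact: mclt.
by move=> x /= /le_lt_trans; apply; rewrite lt_min; apply/andP; split; lra.
Qed.

Lemma ae_cdfr_itv : {ae mu, forall x, 0 < cdfr (phi x) < 1}.
Proof.
have H0 : mu [set x | cdfr (phi x) <= 0] = 0%E.
  by rewrite measure_cdfr_le// lexx ler01.
have H1 : mu.-negligible [set x | 1 <= cdfr (phi x)].
  have -> : [set x | 1 <= cdfr (phi x)] =
      ~` \bigcup_n [set x | cdfr (phi x) <= 1 - n.+1%:R^-1].
    rewrite setC_bigcup; apply/seteqP; split => x /=.
      move=> c1 n _ /= /(le_trans c1); rewrite leNgt ltrBlDr ltrDl.
      by rewrite invr_gt0 ltr0Sn.
    move=> H; rewrite leNgt; apply/negP => c1.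
    apply: (H (Num.truncn (1 - cdfr (phi x))^-1) I) => /=.
    rewrite lerBrDr -lerBrDl -[leRHS]invrK lef_pV2 ?posrE ?invr_gt0 ?subr_gt0//.
    by rewrite ltW// truncnS_gt.
  have mB : measurable (\bigcup_n [set x | cdfr (phi x) <= 1 - n.+1%:R^-1]).
    exact: bigcup_measurable.
  apply/negligibleP; first exact: measurableC.
  suff B1 : mu (\bigcup_n [set x | cdfr (phi x) <= 1 - n.+1%:R^-1]) = 1%E.
    by have := probability_setC mu mB; rewrite B1 subee.
  apply/eqP; rewrite eq_le probability_le1//=.
  apply/lee_subgt0Pr => e e0.
  apply: (@le_trans _ _ (mu [set x | cdfr (phi x) <=
      1 - (Num.truncn e^-1).+1%:R^-1])); last first.
    apply: le_measure; rewrite ?inE// => x /= xe.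
    by exists (Num.truncn e^-1).
  rewrite measure_cdfr_le.
    rewrite -EFinB lee_fin lerD2l lerN2 -[leRHS]invrK lef_pV2 ?posrE ?invr_gt0//.
    by rewrite ltW// truncnS_gt.
  by rewrite subr_ge0 gerBl invr_ge0 ler0n andbT invf_le1// ler1n.
have N0 : mu.-negligible [set x | cdfr (phi x) <= 0] by apply/negligibleP.
apply: negligibleS (negligibleU N0 H1) => x /= /negP.
by rewrite negb_and -!leNgt => /orP[]; [left|right].
Qed.

(** A point that is not the smallest one with its value of the distribution
   function has a rational on its left with the same value; the flat piece
   beyond a rational is null by [measure_cdfr_le]. *)
Lemma ae_cdfrK : {ae mu, forall x, quantile (cdfr (phi x)) = phi x}.
Proof.
have N r : mu.-negligible ([set x | cdfr (phi x) <= cdfr r] `\` [set x | phi x <= r]).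
  apply/negligibleP; first exact: measurableD.
  have sub : [set x | phi x <= r] `<=` [set x | cdfr (phi x) <= cdfr r].
    by move=> x /= /cdfr_nd.
  have fin : (mu [set x | (cdfr (phi x) <= cdfr r)%R] < +oo)%E.
    by rewrite (le_lt_trans (probability_le1 _ _))// ltry.
  transitivity ((cdfr r)%:E - (cdfr r)%:E)%E; last by rewrite subee.
  rewrite measureD// (setIidr sub); congr (_ - _)%E; last exact: cdfrE.
  by apply: measure_cdfr_le; exact: cdfr_itv.
have NQ : {ae mu, forall x, forall q : rat,
    ~ (cdfr (phi x) <= cdfr (ratr q) /\ ratr q < phi x)}.
  apply: ae_forall_countable; first exact: countableP.
  move=> q; apply: negligibleS (N (ratr q)) => x /= /contrapT[cx qx].
  by split => //; apply/negP; rewrite -ltNge.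
apply: filterS2 ae_cdfr_itv NQ => x x01 NQ.
apply/eqP; rewrite eq_le quantile_le// lexx /= leNgt; apply/negP => Qx.
have [q] := rat_in_itvoo Qx; rewrite in_itv/= => /andP[Qq qx].
by apply: (NQ q); split => //; rewrite -quantile_le// ltW.
Qed.

End one.

Section two.
Variables mu nu : probability X R.
Hypothesis mu_atomless : forall y, mu [set x | phi x = y] = 0%E.

(** The monotone rearrangement of the law of [phi] under [mu] to its law under
    [nu]. *)
Definition rearrange (y : R) : R :=
  if 0 < cdfr mu y < 1 then quantile nu (cdfr mu y) else 0.

Lemma measurable_rearrange : measurable_fun setT rearrange.
Proof.
apply: (measurability (@RGenOInfty.G R)); first exact: RGenOInfty.measurableE.
move=> _ [_ [r ->] <-]; rewrite setTI.
have mc : measurable_fun setT (cdfr mu : R -> R).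
  by apply: nondecreasing_measurable => // x y; exact: cdfr_nd.
have mb : measurable_fun setT (fun y => 0 < cdfr mu y < 1).
  by apply: measurable_and; apply: measurable_fun_ltr.
have -> : rearrange @^-1` `]r, +oo[ =
  [set y | if 0 < cdfr mu y < 1 then cdfr nu r < cdfr mu y else r < 0].
  apply/seteqP; split => y /=; rewrite in_itv/= andbT /rearrange;
    by case: ifPn => // c01; rewrite !ltNge quantile_le.
have := @measurable_fun_ifT _ _ _ _ (fun y => cdfr nu r < cdfr mu y) (cst (r < 0)) _ mb.
move=> /(_ _ _ measurableT [set true]); rewrite setTI; apply => //.
exact: measurable_fun_ltr.
Qed.

Lemma rearrange_law A : measurable A ->
  mu [set x | A (rearrange (phi x))] = nu [set x | A (phi x)].
Proof.
move: A; have mh : measurable_fun setT (rearrange \o phi).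
  by apply: measurableT_comp => //; exact: measurable_rearrange.
pose h := HB.pack_for {mfun X >-> R} (rearrange \o phi)
  (@isMeasurableFun.Build _ _ _ _ (rearrange \o phi) mh).
apply: (@measure_eq_rays R (distribution mu h) (distribution nu phi)) => r.
rewrite /distribution/= /pushforward.
have mle : measurable [set x | phi x <= r] by exact: measurable_fun_le.
have mc : measurable [set x | cdfr mu (phi x) <= cdfr nu r].
  exact: (measurable_fun_le _ (measurable_cdfr mu)).
transitivity (1 - mu [set x | (cdfr mu (phi x) <= cdfr nu r)%R])%E; last first.
  rewrite [X in _ = nu X](_ : _ = ~` [set x | phi x <= r]); last first.
    by apply/seteqP; split => x /=; rewrite ltNge => /negP.
  rewrite [RHS]probability_setC// measure_cdfr_le//; last exact: cdfr_itv.
  by rewrite cdfrE.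
rewrite -probability_setC//; apply: (@ae_eq_set_measure _ _ _ mu).
- rewrite [X in measurable X](_ : _ = (rearrange \o phi) @^-1` `]r, +oo[).
    by rewrite -[X in measurable X]setTI; exact: (mh measurableT).
  by apply/seteqP; split => x /=; rewrite in_itv/= andbT.
- exact: measurableC.
- apply: filterS (ae_cdfr_itv mu_atomless) => x x01 /=.
  rewrite /rearrange x01 ltNge quantile_le//.
  by split => /negP.
Qed.

End two.

Lemma rearrangeK (mu nu : probability X R) :
  (forall y, mu [set x | phi x = y] = 0%E) ->
  (forall y, nu [set x | phi x = y] = 0%E) ->
  {ae mu, forall x, rearrange nu mu (rearrange mu nu (phi x)) = phi x}.
Proof.
move=> mu0 nu0.
apply: filterS2 (ae_cdfr_itv mu0) (ae_cdfrK mu0) => x x01 xK.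
by rewrite /rearrange x01 quantileK// x01.
Qed.

End cdf.

(** The laws of [phi] under [mu] and [nu] are rearranged into each other; the
   left inverse of [phi] brings the rearrangements back to [X]. *)
Lemma nonatomic_isomorphism (R : realType) d (X : measurableType d)
    (mu nu : probability X R) : standard_borel R X ->
  (forall x, mu [set x] = 0%E) -> (forall x, nu [set x] = 0%E) ->
  exists f g : {mfun X >-> X},
    [/\ (forall A, measurable A -> mu (f @^-1` A) = nu A),
        (forall A, measurable A -> nu (g @^-1` A) = mu A),
        {ae mu, forall x, g (f x) = x} & {ae nu, forall x, f (g x) = x}].
Proof.
move=> sX mu0 nu0.
have [x0] : exists x0 : X, True.
  apply: contrapT => noX; have : mu setT = 0%E.
    rewrite (_ : setT = set0) ?measure0//; apply/seteqP; split => // x _.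
    by case: noX; exists x.
  by rewrite probability_setT => /eqP; rewrite onee_eq0.
move=> _; have [phi [g [mphi mg phiK]]] := standard_borel_embedding x0 sX.
pose phi' := HB.pack_for {mfun X >-> R} phi
  (@isMeasurableFun.Build _ _ _ _ phi mphi).
have fib y : [set x | phi' x = y] = set0 \/ exists x, [set x | phi' x = y] = [set x].
  have [[x xy]|no] := pselect (exists x, phi x = y).
    right; exists x; apply/seteqP; split => z /=; last by move=> ->.
    by rewrite -xy => /(congr1 g); rewrite !phiK.
  by left; apply/seteqP; split => // z /= zy; apply: no; exists z.
have at0 (m : probability X R) : (forall x, m [set x] = 0%E) ->
    forall y, m [set x | phi' x = y] = 0%E.
  by move=> m0 y; case: (fib y) => [->|[x ->]]; rewrite ?measure0.
have mh (m n : probability X R) : (forall x, m [set x] = 0%E) ->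
    (forall x, n [set x] = 0%E) ->
    measurable_fun setT (g \o (rearrange phi' m n \o phi)).
  move=> m0 n0; apply: measurableT_comp => //; apply: measurableT_comp => //.
  exact: measurable_rearrange.
have mI : measurable [set y | phi (g y) = y].
  rewrite [X in measurable X](_ : _ = (fun y => phi (g y) - y) @^-1` [set 0]).
    rewrite -[X in measurable X]setTI.
    suff : measurable_fun setT (fun y => phi (g y) - y) by apply => //.
    by apply: measurable_funB => //; exact: measurableT_comp.
  apply/seteqP; split => y /=; first by move=> ->; rewrite subrr.
  by move=> /eqP; rewrite subr_eq0 => /eqP.
have law (m n : probability X R) (m0 : forall x, m [set x] = 0%E)
    (n0 : forall x, n [set x] = 0%E) A : measurable A ->
    m [set x | A (g (rearrange phi' m n (phi x)))] = n A.
  move=> mA; have mgA : measurable (g @^-1` A).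
    by rewrite -[X in measurable X]setTI; exact: mg.
  rewrite [LHS](rearrange_law n (at0 _ m0) mgA).
  by congr (n _); apply/seteqP; split => x /=; rewrite phiK.
have inv (m n : probability X R) (m0 : forall x, m [set x] = 0%E)
    (n0 : forall x, n [set x] = 0%E) :
    {ae m, forall x, g (rearrange phi' n m (phi (g (rearrange phi' m n (phi x))))) = x}.
  have aeI : {ae m, forall x, phi (g (rearrange phi' m n (phi x))) =
      rearrange phi' m n (phi x)}.
    exists [set x | ~ (phi (g (rearrange phi' m n (phi x))) =
      rearrange phi' m n (phi x))]; split => //.
      have := measurableC mI => mIC.
      rewrite -[X in measurable X]setTI.
      have := measurableT_comp (measurable_rearrange phi' m n) mphi.
      by move=> /(_ measurableT _ mIC).
    rewrite (rearrange_law n (at0 _ m0) (measurableC mI)).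
    rewrite [X in n X](_ : _ = set0) ?measure0//.
    by apply/seteqP; split => // x /=; rewrite phiK.
  apply: filterS2 aeI (rearrangeK (at0 _ m0) (at0 _ n0)) => x -> /= ->.
  exact: phiK.
pose f1 := HB.pack_for {mfun X >-> X} (g \o (rearrange phi' mu nu \o phi))
  (@isMeasurableFun.Build _ _ _ _ _ (mh _ _ mu0 nu0)).
pose f2 := HB.pack_for {mfun X >-> X} (g \o (rearrange phi' nu mu \o phi))
  (@isMeasurableFun.Build _ _ _ _ _ (mh _ _ nu0 mu0)).
exists f1, f2; split; [exact: law|exact: law|exact: inv|exact: inv].
Qed.

(** * Restrictions of an extreme point to invariant sets *)

Section transport_action.
Context (R : realType) (G : groupType) (G_countable : countable [set: G]).
Context d1 (T1 : measurableType d1) (mu1 : probability T1 R)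
  d2 (T2 : measurableType d2) (mu2 : probability T2 R).
Variable a : mpaction G mu2.
Variables (f : {mfun T1 >-> T2}) (g : {mfun T2 >-> T1}).
Hypotheses (fmu : forall A, measurable A -> mu1 (f @^-1` A) = mu2 A)
  (gf : {ae mu1, forall x, g (f x) = x})
  (fg : {ae mu2, forall y, f (g y) = y}).

Let mf A : measurable A -> measurable (f @^-1` A).
Proof. exact: measurable_funPTI. Qed.

Let mg A : measurable A -> measurable (g @^-1` A).
Proof. exact: measurable_funPTI. Qed.

(** The pullback of an action along an isomorphism mod null sets satisfies the
   group laws only almost everywhere; it becomes a genuine action once it is
   made trivial off an invariant conull set on which the isomorphism is
   bijective along whole orbits. *)
Lemma transport_action : exists b : mpaction G mu1,
  forall h, {ae mu1, forall x, f (b h x) = a h (f x)}.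
Proof.
have [N1 [mN1 N10 sN1]] := gf.
have [N2 [mN2 N20 sN2]] := fg.
pose S := [set y | forall h, ~ N2 (a h y)].
pose D := f @^-1` S `&` ~` N1.
have mS : measurable S.
  apply: (measurable_forall_countable (P := fun h => ~` (a h @^-1` N2))) => // h.
  by apply: measurableC; exact: measurable_act_preimage.
have mD : measurable D by apply: measurableI; [exact: mf|exact: measurableC].
have S1 : {ae mu2, forall y, S y}.
  apply: ae_forall_countable => // h; exists (a h @^-1` N2); split.
  - exact: measurable_act_preimage.
  - by rewrite /= act_preserves.
  - by move=> y /=; exact: contrapT.
have D1 : {ae mu1, forall x, D x}.
  have [M [mM M0 sM]] := S1.
  have : mu1.-negligible (f @^-1` M `|` N1).
    apply: negligibleU; apply/negligibleP => //; first exact: mf.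
    exact: etrans (fmu mM) M0.
  apply: negligibleS => x /= nD.
  have [N1x|nN1x] := pselect (N1 x); [by right|left].
  by apply: sM => /= Sfx; apply: nD; split.
have gfD x : D x -> g (f x) = x.
  by move=> [_ nN]; apply: contrapT => h; apply: nN; exact: sN1.
have fgS y : S y -> f (g y) = y.
  by move=> Sy; apply: contrapT => h; apply: (Sy 1%g); rewrite act1; exact: sN2.
have aS h y : S y -> S (a h y).
  by move=> Sy k; rewrite -actM; exact: Sy.
have gS y : S y -> ~ N1 (g y) -> D (g y).
  by move=> Sy nN; split => //=; rewrite fgS.
(* [N1] need not be invariant, so the whole orbit has to avoid it *)
pose D' := D `&` [set x | forall h, ~ N1 (g (a h (f x)))].
have mN1h h : measurable ((fun x => g (a h (f x))) @^-1` N1).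
  by apply: (mf (A := a h @^-1` (g @^-1` N1))); apply: measurable_act_preimage; exact: mg.
have mgN1 A : measurable A -> mu2 (g @^-1` A) = mu1 A.
  move=> mA; rewrite -fmu; last exact: mg.
  apply: ae_eq_set_measure => //; first exact/mf/mg.
  by apply: filterS gf => x /= ->.
have N1h h : mu1 ((fun x => g (a h (f x))) @^-1` N1) = 0%E.
  transitivity (mu1 (f @^-1` (a h @^-1` (g @^-1` N1)))) => //.
  rewrite fmu; last by apply: measurable_act_preimage; exact: mg.
  by rewrite act_preserves; [rewrite mgN1|exact: mg].
have mD' : measurable D'.
  apply: measurableI => //.
  apply: (measurable_forall_countable
    (P := fun h => ~` ((fun x => g (a h (f x))) @^-1` N1))) => // h.
  exact: measurableC.
have D'1 : {ae mu1, forall x, D' x}.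
  have : {ae mu1, forall x, forall h, ~ N1 (g (a h (f x)))}.
    apply: ae_forall_countable => // h.
    exists ((fun x => g (a h (f x))) @^-1` N1).
    by split; [exact: mN1h|exact: N1h|move=> x /=; exact: contrapT].
  by apply: filterS2 D1 => x ? ?; split.
pose b h x := if x \in D' then g (a h (f x)) else x.
have bD' h x : D' x -> D' (b h x).
  move=> D'x; rewrite /b mem_set//; have [[Sfx _] N1x] := D'x.
  split; first by apply: gS; [exact: aS|exact: N1x].
  by move=> k /=; rewrite fgS; [rewrite -actM; exact: N1x|exact: aS].
have b1 x : b 1%g x = x.
  by rewrite /b; case: ifPn => //; rewrite inE => -[Dx _]; rewrite act1 gfD.
have bM h k x : b (h * k)%g x = b h (b k x).
  have [D'x|nD'x] := pselect (D' x); last by rewrite /b memNset// memNset.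
  rewrite {1 2}/b (mem_set D'x) (mem_set (bD' k _ D'x)) /b (mem_set D'x).
  rewrite fgS; first by rewrite actM.
  by apply: aS; case: D'x => -[].
have mb h : measurable_fun setT (b h).
  apply: measurable_fun_ifT => //.
  - apply: (@measurable_fun_bool _ _ _ _ true).
    rewrite setTI [X in measurable X](_ : _ = D')//.
    by apply/seteqP; split => x /=; [exact: set_mem|exact: mem_set].
  - by apply: measurableT_comp => //; apply: measurableT_comp => //; exact: measurable_act.
have bpres h A : measurable A -> mu1 (b h @^-1` A) = mu1 A.
  move=> mA; rewrite -[RHS]mgN1//.
  rewrite -(act_preserves a h); last exact: mg.
  rewrite -fmu; last by apply: measurable_act_preimage; exact: mg.
  apply: ae_eq_set_measure.
  - by rewrite -[X in measurable X]setTI; exact: mb.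
  - by apply: mf; apply: measurable_act_preimage; exact: mg.
  - by apply: filterS D'1 => x D'x /=; rewrite /b mem_set.
exists (Mpaction b1 bM mb bpres) => h; apply: filterS D'1 => x D'x /=.
by rewrite /b mem_set// fgS//; apply: aS; case: D'x => -[].
Qed.

End transport_action.

Lemma mnormalizeE (R : realType) d (T : measurableType d)
    (m : {measure set T -> \bar R}) (P : probability T R) A :
  (m setT == 0%E) || (m setT == +oo%E) = false ->
  mnormalize m P A = (m A * (fine (m setT))^-1%:E)%E.
Proof. by rewrite /mnormalize => ->. Qed.

Section conditional.
Context (R : realType) d (T : measurableType d) (mu : probability T R).
Variables (E : set T) (mE : measurable E).

Definition cond_prob : probability T R := mnormalize (mrestr mu mE) mu.

Hypothesis E0 : (0 < mu E)%E.

Lemma condE A : cond_prob A = (mu (A `&` E) * (fine (mu E))^-1%:E)%E.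
Proof.
have E1 : (mu (setT `&` E) == 0%E) || (mu (setT `&` E) == +oo%E) = false.
  rewrite setTI gt_eqF//= lt_eqF// (le_lt_trans (probability_le1 _ _))//.
  exact: ltry.
have h : cond_prob A = (mu (A `&` E) * (fine (mu (setT `&` E)))^-1%:E)%E.
  exact: (@mnormalizeE R d T (mrestr mu mE) mu A E1).
by rewrite h setTI.
Qed.

Lemma fine_measure_gt0 : 0 < fine (mu E).
Proof. by rewrite fine_gt0// E0 (le_lt_trans (probability_le1 _ _))// ltry. Qed.

Lemma condM A : measurable A -> ((fine (mu E))%:E * cond_prob A = mu (A `&` E))%E.
Proof.
move=> mA; rewrite condE muleC -muleA -EFinM mulVf ?mule1//.
by rewrite gt_eqF// fine_measure_gt0.
Qed.

Lemma cond_ae (P : T -> Prop) :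
  {ae cond_prob, forall x, P x} -> {ae mu, forall x, E x -> P x}.
Proof.
move=> [N [mN N0 sN]]; exists (N `&` E); split; first exact: measurableI.
  by rewrite -condM// N0 mule0.
by move=> x /= /not_implyP[Ex nPx]; split => //; exact: sN.
Qed.

Context (G : groupType) (a : mpaction G mu).
Hypothesis aE : forall g, {ae mu, forall x, E (a g x) <-> E x}.

Lemma cond_preserves g A : measurable A -> cond_prob (a g @^-1` A) = cond_prob A.
Proof.
move=> mA; rewrite !condE; congr (_ * _)%E.
rewrite -[RHS](act_preserves a g); last exact: measurableI.
apply: ae_eq_set_measure.
- by apply: measurableI => //; exact: measurable_act_preimage.
- by apply: measurable_act_preimage; exact: measurableI.
- by apply: filterS (aE g) => x Ex /=; split=> -[? ?]; split => //; apply/Ex.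
Qed.

Definition restrict_act : mpaction G cond_prob :=
  Mpaction (act1 a) (actM a) (measurable_act a) cond_preserves.

End conditional.

Lemma standard_borel_set1 (R : realType) d (X : measurableType d) :
  standard_borel R X -> forall x : X, measurable [set x].
Proof.
move=> sX x; have [phi [g [mphi mg phiK]]] := standard_borel_embedding x sX.
rewrite (_ : [set x] = phi @^-1` [set phi x]).
  by rewrite -[X in measurable X]setTI; exact: mphi.
apply/seteqP; split => y /=; first by move=> ->.
by move=> /(congr1 g); rewrite !phiK.
Qed.

Lemma nonatomic_set1 (R : realType) d (X : measurableType d)
    (mu : probability X R) : standard_borel R X -> nonatomic mu ->
  forall x, mu [set x] = 0%E.
Proof.
move=> sX na x.
have m1 := standard_borel_set1 sX x.
apply/eqP; rewrite eq_le measure_ge0 andbT leNgt; apply/negP => /(na _ m1).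
move=> [B [mB /subset_set1[->|->]]]; first by rewrite measure0 ltxx.
by rewrite ltxx.
Qed.

Section extreme.
Context (R : realType) (G : groupType) (G_countable : countable [set: G]).
Context d (X : measurableType d) (mu : probability X R).
Hypotheses (X_standard : standard_borel R X) (mu_nonatomic : nonatomic mu).

Lemma dsum_ae (t : R) (P : X * bool -> Prop) : 0 <= t <= 1 ->
  {ae mu, forall x, P (x, true)} -> {ae mu, forall x, P (x, false)} ->
  {ae dsum_prob mu t, forall p, P p}.
Proof.
move=> t01 [N1 [mN1 N10 s1]] [N2 [mN2 N20 s2]].
exists (N1 `*` [set true] `|` N2 `*` [set false]).
have mN : measurable (N1 `*` [set true] `|` N2 `*` [set false]).
  by apply: measurableU; exact: measurableX.
split => //.
- rewrite dsum_probE//.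
  rewrite (_ : ysection _ true = N1); last first.
    apply/seteqP; split => x; rewrite ysectionE/=; last by left.
    by move=> [[]|[]].
  rewrite (_ : ysection _ false = N2); last first.
    apply/seteqP; split => x; rewrite ysectionE/=; last by right.
    by move=> [[]|[]].
  by rewrite [X in (_ * X + _)%E]N10 [X in (_ + _ * X)%E]N20 !mule0 adde0.
- by move=> [x []] /= nP; [left|right]; split => //=; [exact: s1|exact: s2].
Qed.

(** By the isomorphism theorem both restrictions can be carried over to
   [(X, mu)]; gluing the two isomorphisms identifies the disjoint sum of the
   transported actions with [a]. *)
Lemma restriction_convex_comb (a : mpaction G mu) (E : set X)
    (mE : measurable E) (t : R) : 0 < t < 1 -> mu E = t%:E ->
  forall (E0 : (0 < mu E)%E) (aE : forall g, {ae mu, forall x, E (a g x) <-> E x}),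
  exists b c : mpaction G mu,
    isomorphic b (restrict_act mE E0 aE) /\ isomorphic (dsum t b c) a.
Proof.
move=> t01 muE E0 aE.
have /andP[t0 t1] := t01.
have mEC := measurableC mE.
have muEC : mu (~` E) = (1 - t)%:E by rewrite probability_setC// muE.
have EC0 : (0 < mu (~` E))%E by rewrite muEC lte_fin subr_gt0.
have aEC g : {ae mu, forall x, (~` E) (a g x) <-> (~` E) x}.
  by apply: filterS (aE g) => x /= ->.
have mu1 := nonatomic_set1 X_standard mu_nonatomic.
have m1 := standard_borel_set1 X_standard.
have cond1 (F : set X) (mF : measurable F) : (0 < mu F)%E ->
    forall x, cond_prob mu mF [set x] = 0%E.
  move=> F0 x; rewrite condE// (_ : mu _ = 0%E) ?mul0e//.
  apply/eqP; rewrite eq_le measure_ge0 andbT -(mu1 x).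
  by apply: le_measure; rewrite ?inE//; exact: measurableI.
have [f1 [g1 [f1mu g1mu gf1 fg1]]] :=
  nonatomic_isomorphism X_standard mu1 (cond1 _ mE E0).
have [f2 [g2 [f2mu g2mu gf2 fg2]]] :=
  nonatomic_isomorphism X_standard mu1 (cond1 _ mEC EC0).
have [b bE] := transport_action G_countable (restrict_act mE E0 aE) f1mu gf1 fg1.
have [c cE] := transport_action G_countable (restrict_act mEC EC0 aEC) f2mu gf2 fg2.
exists b, c; split; first by exists f1, g1; split.
have f1E : {ae mu, forall x, E (f1 x)}.
  exists (f1 @^-1` (~` E)); split => //.
  - exact: measurable_funPTI.
  - rewrite f1mu// condE// (_ : ~` E `&` E = set0) ?measure0 ?mul0e//.
    by rewrite setICl.
have f2E : {ae mu, forall x, ~ E (f2 x)}.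
  exists (f2 @^-1` E); split => //.
  - exact: measurable_funPTI.
  - rewrite f2mu// condE// (_ : E `&` ~` E = set0) ?measure0 ?mul0e//.
    by rewrite setICr.
  - by move=> x /= /contrapT.
pose F (p : X * bool) := if p.2 then f1 p.1 else f2 p.1.
pose H (y : X) := if y \in E then (g1 y, true) else (g2 y, false).
have mF : measurable_fun setT F.
  by apply: measurable_fun_ifT => //; apply: measurableT_comp => //; exact: measurable_fst.
have mH : measurable_fun setT H.
  apply: measurable_fun_ifT.
  - apply: (@measurable_fun_bool _ _ _ _ true).
    rewrite setTI [X in measurable X](_ : _ = E)//.
    by apply/seteqP; split => x /=; [exact: set_mem|exact: mem_set].
  - by apply: measurable_fun_pair => //; exact: measurable_funPT.
  - by apply: measurable_fun_pair => //; exact: measurable_funPT.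
pose F' := HB.pack_for {mfun (X * bool)%type >-> X} F
  (@isMeasurableFun.Build _ _ _ _ _ mF).
pose H' := HB.pack_for {mfun X >-> (X * bool)%type} H
  (@isMeasurableFun.Build _ _ _ _ _ mH).
have t01' : 0 <= t <= 1 by rewrite !ltW.
exists F', H'; split.
- move=> A mA; rewrite dsum_probE//; last first.
    by rewrite -[X in measurable X]setTI; exact: (mF measurableT).
  transitivity (t%:E * mu (f1 @^-1` A) + (1 - t)%:E * mu (f2 @^-1` A))%E.
    by congr (_ * mu _ + _ * mu _)%E; apply/seteqP; split => x; rewrite ysectionE.
  rewrite f1mu// f2mu//.
  have := condM mE E0 mA; have := condM mEC EC0 mA.
  rewrite muE muEC /= => -> ->; rewrite -measureU//; [|exact: measurableI..|].
    by rewrite -setIUr setUv setIT.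
  by rewrite setIACA setICr setI0.
- apply: dsum_ae => //=.
    by apply: filterS2 f1E gf1 => x Ex gfx; rewrite /H /F/= mem_set// gfx.
  by apply: filterS2 f2E gf2 => x Ex gfx; rewrite /H /F/= memNset// gfx.
- apply: filterS2 (cond_ae E0 fg1) (cond_ae EC0 fg2) => y h1 h2.
  rewrite /= /F /H; have [Ey|nEy] := pselect (E y).
    by rewrite mem_set//; exact: h1.
  by rewrite memNset//; exact: h2.
- by move=> h; apply: dsum_ae => //=; [exact: bE|exact: cE].
Qed.

(** This is what extremality is used for: [a] is a convex combination of its
   restrictions to [E] and to the complement, so both are weakly equivalent
   to [a].  If [E] has measure one, the restriction is [a] itself. *)
Lemma extreme_restriction (a : mpaction G mu) (E : set X) (mE : measurable E)
    (E0 : (0 < mu E)%E) (aE : forall g, {ae mu, forall x, E (a g x) <-> E x}) :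
  extreme_point (weq_class a) -> weakly_contained (restrict_act mE E0 aE) a.
Proof.
move=> [_ ext].
have [muE1|muE1] := eqVneq (mu E) 1%E.
  apply/weakly_containedP => I A F e mA finF e0; exists A; split => // g Fg i j.
  rewrite /corr [X in fine X - _](_ : _ = mu ((a g @` A i) `&` A j)).
    by rewrite subrr normr0.
  rewrite condE// muE1 /= invr1 mule1; apply: ae_eq_set_measure.
  - apply: measurableI => //; apply: measurableI => //.
    exact: measurable_act_image.
  - by apply: measurableI => //; exact: measurable_act_image.
  - have : mu.-negligible (~` E).
      apply/negligibleP; first exact: measurableC.
      by have := probability_setC mu mE; rewrite muE1 subee.
    apply: negligibleS => x /= nEx; move=> Ex; apply: nEx.
    by split => [[]|].
pose t := fine (mu E).
have muEt : mu E = t%:E by rewrite fineK// fin_num_measure.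
have t01 : 0 < t < 1.
  rewrite -!lte_fin -muEt E0/= lt_def eq_sym muE1 probability_le1//.
have [b [c [bE dE]]] := restriction_convex_comb mE t01 muEt E0 aE.
have t01' : 0 <= t <= 1 by case/andP: t01 => ? ?; rewrite !ltW.
have [||//|ba _] := ext t (weq_class b) (weq_class c) t01.
- by exists b.
- by exists c.
- apply/seteqP; split => k.
    move=> ak; exists b, c, a; split => //; exact: weakly_equivalent_refl.
  move=> [b' [c' [k' [bb' cc' dk k'k]]]].
  apply: weakly_equivalent_trans k'k.
  apply: weakly_equivalent_trans (isomorphic_weakly_equivalent dk).
  apply: (weakly_equivalent_trans (b := dsum t b c)).
    by apply: weakly_equivalent_sym; exact: isomorphic_weakly_equivalent.
  exact: dsum_weakly_equivalent.
have ab : weakly_equivalent b a.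
  have : weq_class b a by rewrite ba; exact: weakly_equivalent_refl.
  by [].
have [_ re] := isomorphic_weakly_equivalent bE.
by case: ab => ab _; exact: weakly_contained_trans re ab.
Qed.

End extreme.

(** * Mean ergodic theorem for averages of indicator functions *)

Section bounded_measurable.
Context (R : realType) d (T : measurableType d) (P : probability T R).
Implicit Types f g : T -> R.

Definition bmfun f := measurable_fun setT f /\ exists M, forall x, `|f x| <= M.

Lemma bmfun_integrable f : bmfun f -> P.-integrable setT (EFin \o f).
Proof.
move=> [mf [M fM]]; apply: (@le_integrable _ _ _ _ _ measurableT _ (EFin \o cst M)).
- exact/measurable_EFinP.
- by move=> x _ /=; rewrite lee_fin (le_trans (fM x))// ler_norm.
- apply: finite_measure_integrable_cst => //.
Qed.

Lemma bmfun_cst c : bmfun (cst c).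
Proof. by split; [exact: measurable_cst|exists `|c| => x]. Qed.

Lemma bmfunD f g : bmfun f -> bmfun g -> bmfun (fun x => f x + g x).
Proof.
move=> [mf [M fM]] [mg [N gN]]; split; first exact: measurable_funD.
by exists (M + N) => x; rewrite (le_trans (ler_normD _ _))// lerD.
Qed.

Lemma bmfunM f g : bmfun f -> bmfun g -> bmfun (fun x => f x * g x).
Proof.
move=> [mf [M fM]] [mg [N gN]]; split; first exact: measurable_funM.
by exists (M * N) => x; rewrite normrM ler_pM.
Qed.

Lemma bmfunZ c f : bmfun f -> bmfun (fun x => c * f x).
Proof. by apply: bmfunM; exact: bmfun_cst. Qed.

Lemma bmfunB f g : bmfun f -> bmfun g -> bmfun (fun x => f x - g x).
Proof.
move=> [mf [M fM]] [mg [N gN]]; split; first exact: measurable_funB.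
by exists (M + N) => x; rewrite (le_trans (ler_normB _ _))// lerD.
Qed.

Lemma bmfun_norm f : bmfun f -> bmfun (fun x => `|f x|).
Proof.
move=> [mf [M fM]]; split; first exact: measurableT_comp.
by exists M => x; rewrite normr_id.
Qed.

Lemma bmfun_indic A : measurable A -> bmfun (\1_A).
Proof.
move=> mA; split; first exact: measurable_indic.
by exists 1 => x; rewrite indicE; case: (_ \in _); rewrite ?normr1 ?normr0.
Qed.

Lemma meanD f g : bmfun f -> bmfun g ->
  \int[P]_x (f x + g x) = \int[P]_x f x + \int[P]_x g x.
Proof. by move=> bf bg; rewrite RintegralD//; exact: bmfun_integrable. Qed.

Lemma meanB f g : bmfun f -> bmfun g ->
  \int[P]_x (f x - g x) = \int[P]_x f x - \int[P]_x g x.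
Proof. by move=> bf bg; rewrite RintegralB//; exact: bmfun_integrable. Qed.

Lemma meanZ c f : bmfun f -> \int[P]_x (c * f x) = c * \int[P]_x f x.
Proof. by move=> bf; rewrite RintegralZl//; exact: bmfun_integrable. Qed.

Lemma mean_cst (c : R) : \int[P]_x c = c.
Proof. by rewrite Rintegral_cst// [fine _](congr1 fine (probability_setT P)) mulr1. Qed.

Lemma le_mean f g : bmfun f -> bmfun g -> (forall x, f x <= g x) ->
  \int[P]_x f x <= \int[P]_x g x.
Proof. by move=> bf bg fg; apply: le_Rintegral => //; exact: bmfun_integrable. Qed.

Lemma mean_indic A : measurable A -> \int[P]_x \1_A x = fine (P A).
Proof. by move=> mA; rewrite /Rintegral integral_indic// setIT. Qed.

Lemma mean_EFin f : bmfun f -> (\int[P]_x (f x)%:E)%E = (\int[P]_x f x)%:E.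
Proof.
move=> bf; rewrite /Rintegral fineK//; apply: integrable_fin_num => //.
exact: bmfun_integrable.
Qed.

(** Integrate the inequality [`|f x| <= (f x ^+ 2 / e + e) / 2]. *)
Lemma mean_norm_le f (e : R) : bmfun f -> 0 < e ->
  \int[P]_x (f x ^+ 2) <= e ^+ 2 -> \int[P]_x `|f x| <= e.
Proof.
move=> bf e0 fe.
have b2 : bmfun (fun x => f x ^+ 2) by apply: bmfunM.
have b3 : bmfun (fun x => (2 * e)^-1 * f x ^+ 2) by apply: bmfunZ.
have -> : e = (2 * e)^-1 * e ^+ 2 + e / 2.
  by field; rewrite gt_eqF.
apply: (@le_trans _ _ (\int[P]_x ((2 * e)^-1 * f x ^+ 2 + e / 2))).
  apply: le_mean; first exact: bmfun_norm.
    by apply: bmfunD => //; exact: bmfun_cst.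
  move=> x; rewrite -subr_ge0.
  have -> : (2 * e)^-1 * f x ^+ 2 + e / 2 - `|f x| =
    (2 * e)^-1 * (`|f x| - e) ^+ 2.
    by rewrite sqrrB real_normK ?num_real//; field; rewrite gt_eqF.
  by rewrite mulr_ge0 ?sqr_ge0// invr_ge0 mulr_ge0// ltW.
rewrite meanD//; last exact: bmfun_cst.
by rewrite (meanZ (2 * e)^-1 b2) mean_cst lerD2r ler_wpM2l// invr_ge0 mulr_ge0// ltW.
Qed.

(** The sum of the integrals is finite, hence so is almost everywhere the sum
   of the functions. *)
Lemma ae_summable (h : nat -> T -> R) :
  (forall n, bmfun (h n)) -> (forall n, \int[P]_x `|h n x| <= 2^-1 ^+ n) ->
  {ae P, forall x, cvgn (series (fun n => `|h n x|))}.
Proof.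
move=> bh hle.
pose F (x : T) : \bar R := (\sum_(n <oo) (`|h n x|)%:E)%E.
have mF n : measurable_fun setT (fun x => (`|h n x|)%:E).
  by apply/measurable_EFinP; case: (bmfun_norm (bh n)).
have F0 : (forall x, 0 <= F x)%E by move=> x; exact: nneseries_ge0.
have iF : P.-integrable setT F.
  apply/integrableP; split; first exact: ge0_emeasurable_sum.
  under eq_integral do rewrite gee0_abs//.
  rewrite integral_nneseries//.
  apply: (@le_lt_trans _ _ (\sum_(n <oo) (2^-1 ^+ n)%:E)%E).
    apply: lee_nneseries => [n _ _|n _]; first exact: integral_ge0.
    by rewrite (mean_EFin (bmfun_norm (bh n))) lee_fin.
  have cg : series (fun n => (2^-1 : R) ^+ n) @ \oo --> ((1 - 2^-1)^-1 : R).
    have := @cvg_geometric_series R 1 2^-1; rewrite mul1r /geometric.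
    under eq_fun do rewrite mul1r.
    by apply; rewrite ger0_norm// invf_lt1// ltr1n.
  rewrite (_ : (\sum_(n <oo) _)%E = ((1 - 2^-1)^-1)%:E) ?ltry//.
  apply/cvg_lim => //.
  have -> : (fun n => \sum_(0 <= k < n) (2^-1 ^+ k)%:E)%E =
      EFin \o series (fun n => (2^-1 : R) ^+ n).
    by apply/funext => n; rewrite /= sumEFin.
  by apply: cvg_EFin => //; exact: nearW.
apply: filterS (integrable_ae measurableT iF) => x /(_ Logic.I) Fx.
apply: nondecreasing_is_cvgn.
  by apply: nondecreasing_series => n _ _.
exists (fine (F x)) => _ [n _ <-].
rewrite -lee_fin fineK// /series/= -sumEFin.
by apply: nneseries_lim_ge.
Qed.

End bounded_measurable.

Section ae.
Context (R : realType) d (T : measurableType d) (P : probability T R).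

Lemma ae_exists (Q : T -> Prop) : {ae P, forall x, Q x} -> exists x, Q x.
Proof.
move=> [N [mN N0 sN]]; apply: contrapT => noQ.
have /seteqP[_ NT] : N = setT.
  by rewrite -subTset => x _; apply: sN => Qx; apply: noQ; exists x.
have := probability_setT P; rewrite (_ : setT = N) ?N0; last first.
  by apply/seteqP; split.
by move=> /esym/eqP; rewrite onee_eq0.
Qed.

Lemma measure1_ae (A : set T) : measurable A -> P A = 1%E ->
  {ae P, forall x, A x}.
Proof.
move=> mA A1; exists (~` A); split => //; first exact: measurableC.
by have := probability_setC P mA; rewrite A1 subee.
Qed.

Lemma bounded_mean_cvg (f : nat -> T -> R) (c : R) :
  (forall n, measurable_fun setT (f n)) -> (forall n x, 0 <= f n x <= 1) ->
  {ae P, forall x, f n x @[n --> \oo] --> c} ->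
  (\int[P]_x f n x) @[n --> \oo] --> c.
Proof.
move=> mf f01 fc.
have mF n : measurable_fun setT (fun x => (f n x)%:E) by exact/measurable_EFinP.
have fcE : {ae P, forall x, setT x -> (fun n => (f n x)%:E) @ \oo --> cst c%:E x}.
  by apply: filterS fc => x fx _; apply: cvg_EFin; [exact: nearW|exact: fx].
have i1 : P.-integrable setT (cst 1%E).
  exact: (finite_measure_integrable_cst P 1).
have f1 : {ae P, forall x n, setT x -> (`|(f n x)%:E| <= cst 1 x)%E}.
  apply: aeW => x n _; rewrite /= lee_fin ger0_norm; by case/andP: (f01 n x).
have [_ _] := @dominated_convergence _ _ _ P setT measurableT
  (fun n x => (f n x)%:E) (cst c%:E) (cst 1%E) mF (measurable_cst _) fcE i1 f1.
rewrite integral_cst// [X in (_ * X)%E](probability_setT P) mule1 => h.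
exact: fine_cvg h.
Qed.

End ae.

Section averages.
Context (R : realType) (G : groupType).

(** Dyadic convex combinations of group elements.  Midpoints are all the
   convexity that the parallelogram identity asks for, and a tree lends itself
   to induction on bilinear expressions. *)
Inductive average := Leaf of G | Mid of average & average.

Fixpoint avg (q : G -> R) (t : average) : R :=
  match t with
  | Leaf g => q g
  | Mid t1 t2 => (avg q t1 + avg q t2) / 2
  end.

Fixpoint avg_shift (k : G) (t : average) : average :=
  match t with
  | Leaf g => Leaf (g * k)%g
  | Mid t1 t2 => Mid (avg_shift k t1) (avg_shift k t2)
  end.

Fixpoint avg_supp (t : average) : set G :=
  match t with
  | Leaf g => [set g]
  | Mid t1 t2 => avg_supp t1 `|` avg_supp t2
  end.

Lemma finite_avg_supp t : finite_set (avg_supp t).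
Proof.
by elim: t => [g|t1 h1 t2 h2] /=; [exact: finite_set1|rewrite finite_setU].
Qed.

Lemma eq_avg_in q q' t : (forall g, avg_supp t g -> q g = q' g) ->
  avg q t = avg q' t.
Proof.
elim: t => [g|t1 h1 t2 h2] /= qq; first exact: qq.
by rewrite h1 ?h2// => g tg; apply: qq; [right|left].
Qed.

Lemma eq_avg q q' t : q =1 q' -> avg q t = avg q' t.
Proof. by move=> qq; apply: eq_avg_in => g _; exact: qq. Qed.

Lemma avg_cst c t : avg (cst c) t = c.
Proof. by elim: t => [//|t1 h1 t2 h2] /=; rewrite h1 h2; field. Qed.

Lemma avgMl q c t : avg q t * c = avg (fun g => q g * c) t.
Proof. by elim: t => [//|t1 h1 t2 h2] /=; rewrite -h1 -h2; field. Qed.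

Lemma avgMr q c t : c * avg q t = avg (fun g => c * q g) t.
Proof. by elim: t => [//|t1 h1 t2 h2] /=; rewrite -h1 -h2; field. Qed.

Lemma avg_shiftE q k t : avg q (avg_shift k t) = avg (fun g => q (g * k)%g) t.
Proof. by elim: t => [//|t1 h1 t2 h2] /=; rewrite h1 h2. Qed.

Lemma avg_dist q q' e t : (forall g, avg_supp t g -> `|q g - q' g| <= e) ->
  `|avg q t - avg q' t| <= e.
Proof.
elim: t => [g|t1 h1 t2 h2] /= qq; first exact: qq.
have := h1 (fun g tg => qq g (or_introl tg)).
have := h2 (fun g tg => qq g (or_intror tg)).
by rewrite !ler_norml => /andP[? ?] /andP[? ?]; apply/andP; split; lra.
Qed.

End averages.

Section action_averages.
Context (R : realType) (G : groupType).
Context d (T : measurableType d) (P : probability T R) (a : mpaction G P).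
Variables (C : set T) (mC : measurable C).

Definition selfcorr (g h : G) : R :=
  fine (P (a g @^-1` C `&` a h @^-1` C)).

(** The squared L2 norm of the average of the translates of the indicator of
   [C], written with measures of pairwise intersections only, which are the
   quantities that weak containment preserves. *)
Definition avg_norm2 (t : average G) : R :=
  avg (fun g => avg (selfcorr g) t) t.

Let ev (t : average G) (x : T) : R := avg (fun g => \1_(a g @^-1` C) x) t.

Let mCg g : measurable (a g @^-1` C).
Proof. exact: measurable_act_preimage. Qed.

Lemma bmfun_avg (q : G -> T -> R) t : (forall g, bmfun (q g)) ->
  bmfun (fun x => avg (q ^~ x) t).
Proof.
move=> bq; elim: t => [g|t1 h1 t2 h2] /=; first exact: bq.
by apply: bmfunM; [exact: bmfunD|exact: bmfun_cst].
Qed.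

Lemma mean_avg (q : G -> T -> R) t : (forall g, bmfun (q g)) ->
  \int[P]_x avg (q ^~ x) t = avg (fun g => \int[P]_x q g x) t.
Proof.
move=> bq; elim: t => [//|t1 h1 t2 h2] /=.
have b t := bmfun_avg t bq.
under eq_Rintegral do rewrite mulrC.
by rewrite meanZ ?meanD ?h1 ?h2 1?mulrC//; exact: bmfunD.
Qed.

Let bmfun_ev t : bmfun (ev t).
Proof. by apply: bmfun_avg => g; exact: bmfun_indic. Qed.

Let ev_itv t x : 0 <= ev t x <= 1.
Proof.
elim: t => [g|t1 h1 t2 h2] /=; last first.
  by move: h1 h2; rewrite /ev/= => /andP[? ?] /andP[? ?]; apply/andP; split; lra.
by rewrite /ev/= indicE; case: (_ \in _); rewrite ?lexx ?ler01.
Qed.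

Let ev_shift k t x : ev (avg_shift k t) x = ev t (a k x).
Proof.
rewrite /ev avg_shiftE; apply: eq_avg => g; rewrite !indicE; congr (_%:R).
congr nat_of_bool.
by apply/idP/idP; rewrite !inE/= actM.
Qed.

Let mean_ev t : \int[P]_x ev t x = fine (P C).
Proof.
rewrite /ev (@mean_avg (fun g x => \1_(a g @^-1` C) x)); last first.
  by move=> g; exact: bmfun_indic.
rewrite (@eq_avg _ _ _ (cst (fine (P C)))) ?avg_cst// => g.
by rewrite mean_indic// act_preserves.
Qed.

Let mean_ev2 t : \int[P]_x (ev t x ^+ 2) = avg_norm2 t.
Proof.
transitivity (\int[P]_x avg (fun g => avg (fun h =>
    \1_(a g @^-1` C `&` a h @^-1` C) x : R) t) t).
  apply: eq_Rintegral => x _; rewrite expr2 {1}/ev avgMl; apply: eq_avg => g.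
  rewrite /ev avgMr; apply: eq_avg => h.
  by rewrite indicI.
have bI g h : bmfun (\1_(a g @^-1` C `&` a h @^-1` C) : T -> R).
  by apply: bmfun_indic; exact: measurableI.
rewrite (@mean_avg (fun g x => avg (fun h =>
    \1_(a g @^-1` C `&` a h @^-1` C) x : R) t)); last first.
  by move=> g; apply: (@bmfun_avg (fun h x => \1_(a g @^-1` C `&` a h @^-1` C) x)).
apply: eq_avg => g.
rewrite (@mean_avg (fun h x => \1_(a g @^-1` C `&` a h @^-1` C) x))//.
by apply: eq_avg => h; rewrite mean_indic//; exact: measurableI.
Qed.

(** Jensen: averaging over translates does not change the mean. *)
Lemma avg_norm2_ge t : fine (P C) ^+ 2 <= avg_norm2 t.
Proof.
set c := fine (P C).
have b1 : bmfun (fun x => ev t x ^+ 2) by apply: bmfunM; exact: bmfun_ev.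
have b2 : bmfun (fun x => 2 * c * ev t x) by apply: bmfunZ; exact: bmfun_ev.
have : 0 <= \int[P]_x ((ev t x ^+ 2 - 2 * c * ev t x) + c ^+ 2).
  apply: Rintegral_ge0 => x _.
  by rewrite (_ : _ + _ = (ev t x - c) ^+ 2) ?sqr_ge0//; ring.
rewrite meanD; [|exact: bmfunB|exact: bmfun_cst].
by rewrite meanB// meanZ// mean_ev mean_ev2 mean_cst -/c; lra.
Qed.

Let parallelogram t s :
  \int[P]_x ((ev t x - ev s x) ^+ 2) =
  2 * avg_norm2 t + 2 * avg_norm2 s - 4 * avg_norm2 (Mid t s).
Proof.
have b u : bmfun (fun x => ev u x ^+ 2) by apply: bmfunM; exact: bmfun_ev.
have bZ c u : bmfun (fun x => c * ev u x ^+ 2) by apply: bmfunZ.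
transitivity (\int[P]_x ((2 * ev t x ^+ 2 + 2 * ev s x ^+ 2) -
    4 * ev (Mid t s) x ^+ 2)).
  by apply: eq_Rintegral => x _; rewrite /ev/=; field.
rewrite meanB//; last exact: bmfunD.
by rewrite meanD// !meanZ// !mean_ev2.
Qed.

Let avg_norm2_shift k t : avg_norm2 (avg_shift k t) = avg_norm2 t.
Proof.
rewrite /avg_norm2 avg_shiftE; apply: eq_avg => g; rewrite avg_shiftE.
apply: eq_avg => h; rewrite /selfcorr; congr fine.
rewrite -[RHS](act_preserves a k); last exact: measurableI.
by congr (P _); apply/seteqP; split => x /=; rewrite !actM.
Qed.

Hypotheses (G_countable : countable [set: G]) (a_ergodic : ergodic a).

(** Take averages of almost minimal norm.  By the parallelogram identity they
   form a Cauchy sequence and, as their translates have the same norm, are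
   asymptotically invariant.  Hence they converge almost everywhere to an invariant function,
   which is constant by ergodicity and has mean [P C]; the minimal squared norm
   is therefore the square of [P C]. *)
Lemma mean_ergodic (e : R) : 0 < e -> exists t, avg_norm2 t <= fine (P C) ^+ 2 + e.
Proof.
move=> e0.
pose S := range avg_norm2.
have infS : has_inf S.
  split; first by exists (avg_norm2 (Leaf 1%g)); exists (Leaf 1%g).
  by exists 0 => _ [t _ <-]; rewrite (le_trans _ (avg_norm2_ge t))// sqr_ge0.
pose eps n : R := 2^-1 ^+ n.
have eps0 n : 0 < eps n by rewrite exprn_gt0// invr_gt0.
have epsS n : eps n.+1 ^+ 2 <= eps n ^+ 2.
  apply: lerXn2r; rewrite ?nnegrE ?(ltW (eps0 _))//.
  by rewrite /eps exprS ler_piMl ?(ltW (eps0 n))// invf_le1// ler1n.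
have /choice[t_ ht] n : exists t, avg_norm2 t < inf S + eps n ^+ 2 / 4.
  have e4 : 0 < eps n ^+ 2 / 4 by rewrite divr_gt0// exprn_gt0.
  by have [_ [t _ <-] ?] := inf_adherent e4 infS; exists t.
have Sle t : inf S <= avg_norm2 t.
  by apply: ge_inf; [exact: infS.2|exists t].
pose f n := ev (t_ n).
have bf n : bmfun (f n) by exact: bmfun_ev.
have near_min t s n : avg_norm2 t < inf S + eps n ^+ 2 / 4 ->
    avg_norm2 s < inf S + eps n ^+ 2 / 4 ->
    \int[P]_x `|ev t x - ev s x| <= eps n.
  move=> tn sn; apply: mean_norm_le => //; first exact: bmfunB.
  rewrite parallelogram; have := Sle (Mid t s); move: tn sn; lra.
have cauchy : {ae P, forall x, cvg (f n x @[n --> \oo])}.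
  have step n : \int[P]_x `|f n.+1 x - f n x| <= eps n.
    apply: near_min (ht n); apply: lt_le_trans (ht n.+1) _.
    by rewrite lerD2l ler_pM2r ?invr_gt0.
  apply: filterS (ae_summable (fun n => bmfunB (bf n.+1) (bf n)) step) => x.
  move=> /normed_cvg.
  rewrite (_ : series _ = fun n => f n x - f 0%N x); last first.
    by apply/funext => n; rewrite /series/= telescope_sumr.
  move=> /cvg_ex[l fl]; apply/cvg_ex; exists (l + f 0%N x).
  rewrite (_ : (fun n => f n x) = fun n => (f n x - f 0%N x) + f 0%N x).
    by apply: cvgD => //; exact: cvg_cst.
  by apply/funext => n; rewrite subrK.
have invar : {ae P, forall x, forall k, f n (a k x) - f n x @[n --> \oo] --> 0}.
  apply: ae_forall_countable => // k.
  have step n : \int[P]_x `|ev (avg_shift k (t_ n)) x - f n x| <= eps n.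
    by apply: near_min (ht n); rewrite avg_norm2_shift.
  apply: filterS (ae_summable (fun n => bmfunB (bmfun_ev _) (bf n)) step) => x.
  move=> /normed_cvg/cvg_series_cvg_0.
  by under eq_fun do rewrite ev_shift.
(* The quantification over [g] makes [A c] invariant everywhere; almost
   everywhere it is the set where the limit exceeds [c]. *)
pose A (c : R) := [set x | forall g, exists m N, forall n, (N <= n)%N ->
  c + m.+1%:R^-1 <= f n (a g x)].
pose L x := limn (fun n => f n x).
have mA c : measurable (A c).
  apply: measurable_forall_countable => // g.
  rewrite [X in measurable X](_ : _ = \bigcup_m \bigcup_N
    \bigcap_(n in [set n | (N <= n)%N])
      (a g @^-1` [set x | c + m.+1%:R^-1 <= f n x])).
    apply: bigcup_measurable => m _.
    apply: bigcup_measurable => N _; apply: bigcap_measurableType => n _.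
    apply: measurable_act_preimage; apply: measurable_fun_ge.
    exact: (bf n).1.
  apply/seteqP; split => x /=.
    by move=> [m [N mN]]; exists m => //; exists N.
  by move=> [m _ [N _ mN]]; exists m, N.
have iA c g : a g @^-1` A c = A c.
  apply/seteqP; split => x Ax h; last by rewrite -actM; exact: Ax.
  by have := Ax (h * g^-1)%g; rewrite -actM -mulgA mulVg mulg1.
have AP : {ae P, forall x, forall c, A c x <-> c < L x}.
  apply: filterS2 cauchy invar => x cx ix c.
  have cg g : f n (a g x) @[n --> \oo] --> L x.
    rewrite (_ : (fun n => _) = fun n => (f n (a g x) - f n x) + f n x).
      by rewrite -[L x]add0r; apply: cvgD; [exact: ix|exact: cx].
    by apply/funext => n; rewrite subrK.
  split=> [/(_ 1%g)[m [N mN]]|cL g].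
    apply: (@lt_le_trans _ _ (c + m.+1%:R^-1)); first by rewrite ltrDl invr_gt0.
    rewrite -(cvg_lim (@norm_hausdorff _ _) (cg 1%g)).
    by apply: limr_ge; [apply/cvg_ex; exists (L x); exact: cg|exists N].
  pose m := Num.truncn ((L x - c) / 2)^-1.
  have mc : c + m.+1%:R^-1 < L x.
    rewrite -ltrBrDl (@lt_le_trans _ _ ((L x - c) / 2))//.
      rewrite -[ltRHS]invrK ltf_pV2 ?posrE ?invr_gt0 ?divr_gt0 ?subr_gt0//.
      exact: truncnS_gt.
    by rewrite ler_piMr ?subr_ge0 ?ltW// invf_lt1// ltr1n.
  have [N _ NP] := cvgr_ge _ (cg g) _ mc.
  by exists m, N => n; exact: NP.
have L01 c : {ae P, forall x, c < L x} \/ {ae P, forall x, L x <= c}.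
  have [A0|A1] := a_ergodic (mA c) (iA c).
    right; have nA : {ae P, forall x, ~ A c x}.
      by exists (A c); split => // x /contrapT.
    by apply: filterS2 AP nA => x /(_ c)AL nAx; rewrite leNgt; apply/negP => /AL.
  left; apply: filterS2 AP (measure1_ae (mA c) A1) => x /(_ c)AL.
  by move/AL.
have Litv : {ae P, forall x, 0 <= L x <= 1}.
  apply: filterS cauchy => x cx; apply/andP; split.
    by apply: limr_ge => //; apply: nearW => n; case/andP: (ev_itv (t_ n) x).
  by apply: limr_le => //; apply: nearW => n; case/andP: (ev_itv (t_ n) x).
pose K := [set c | {ae P, forall x, c < L x}].
have supK : has_sup K.
  split.
    by exists (-1); apply: filterS Litv => x /andP[L0 _]; rewrite (lt_le_trans _ L0)// ltrN10.
  exists 1 => c Kc.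
  have [x [/ltW cL /andP[_ L1]]] := ae_exists (filterI Kc Litv).
  exact: le_trans cL L1.
(* the constant value of the limit *)
pose kappa := sup K.
have Lk : {ae P, forall x, L x = kappa}.
  have lo : {ae P, forall x, forall q : rat, ratr q < kappa -> ratr q < L x}.
    apply: ae_forall_countable; first exact: countableP.
    move=> q; have [qk|nqk] := pselect (ratr q < kappa); last exact: aeW (fun _ h => False_ind _ (nqk h)).
    have [c Kc qc] := sup_gt supK.1 qk.
    by apply: filterS Kc => x cL _; exact: lt_trans qc cL.
  have hi : {ae P, forall x, forall q : rat, kappa < ratr q -> L x <= ratr q}.
    apply: ae_forall_countable; first exact: countableP.
    move=> q; have [qk|nqk] := pselect (kappa < ratr q); last exact: aeW (fun _ h => False_ind _ (nqk h)).
    have [Kq|] := L01 (ratr q); last by apply: filterS.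
    have : ratr q <= kappa by apply: ub_le_sup => //; exact: supK.2.
    by rewrite leNgt qk.
  apply: filterS2 lo hi => x lo hi; apply/eqP; rewrite eq_le !leNgt.
  apply/andP; split; apply/negP => /rat_in_itvoo[q]; rewrite in_itv/= => /andP[].
    by move=> kq; rewrite ltNge hi.
  by move=> Lq /lo; rewrite ltNge ltW.
have fk : {ae P, forall x, f n x @[n --> \oo] --> kappa}.
  by apply: filterS2 cauchy Lk => x cx <-.
have kC : kappa = fine (P C).
  have H := bounded_mean_cvg (fun n => (bf n).1) (fun n => ev_itv (t_ n)) fk.
  apply/esym/(cvg_unique _ _ H) => //.
  rewrite (_ : (fun n => _) = cst (fine (P C))); first exact: cvg_cst.
  by apply/funext => n; exact: mean_ev.
have H2 : avg_norm2 (t_ n) @[n --> \oo] --> fine (P C) ^+ 2.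
  rewrite -kC (_ : (fun n => _) = fun n => \int[P]_x (f n x ^+ 2)); last first.
    by apply/funext => n; rewrite -mean_ev2.
  apply: (@bounded_mean_cvg _ _ _ P (fun n x => f n x ^+ 2)) => [n|n x|].
  - by apply: measurable_funX; exact: (bf n).1.
  - by have /andP[f0 f1] := ev_itv (t_ n) x; rewrite sqr_ge0 exprn_ile1.
  - by apply: filterS fk => x fx; rewrite expr2; apply: cvgM.
have ce : fine (P C) ^+ 2 < fine (P C) ^+ 2 + e by rewrite ltrDl.
have [N _ NP] := cvgr_le _ H2 _ ce.
by exists (t_ N); apply: (NP N) => /=.
Qed.

End action_averages.

(** * Ergodic actions weakly contained in an integral of actions *)

Section finite_probability.
Context (R : realType) d (T : measurableType d) (P : probability T R).

Lemma fine_setID A B : measurable A -> measurable B ->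
  fine (P A) = fine (P (A `&` B)) + fine (P (A `\` B)).
Proof.
move=> mA mB; have mI := measurableI A B mA mB; have mD := measurableD mA mB.
rewrite -fineD ?fin_num_measure//; congr fine.
rewrite -measureU//; first by rewrite setUIDK.
by rewrite setDE setIACA setICr setI0.
Qed.

Lemma fine_le_measure A B : measurable A -> measurable B -> A `<=` B ->
  fine (P A) <= fine (P B).
Proof.
by move=> mA mB AB; rewrite fine_le ?fin_num_measure//; apply: le_measure; rewrite ?inE.
Qed.

Lemma fine_measure_itv A : measurable A -> 0 <= fine (P A) <= 1.
Proof.
move=> mA; rewrite fine_ge0//= -lee_fin fineK ?fin_num_measure//.
exact: probability_le1.
Qed.

Lemma fine_measure_dist A B : measurable A -> measurable B ->
  `|fine (P A) - fine (P B)| <= fine (P (A `\` B)) + fine (P (B `\` A)).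
Proof.
move=> mA mB; rewrite (fine_setID mA mB) (fine_setID mB mA) setIC.
have /andP[? _] := fine_measure_itv (measurableD mA mB).
have /andP[? _] := fine_measure_itv (measurableD mB mA).
by rewrite ler_norml; apply/andP; split; lra.
Qed.

(** Weak containment controls pairwise intersections only.  A member [D] of
   the family can nevertheless stand for the intersection of two others: this
   is visible from its measure and from its intersections with the two. *)
Lemma near_intersection (D U B : set T) (c e : R) :
  measurable D -> measurable U -> measurable B ->
  `|c - fine (P D)| < e -> `|c - fine (P (D `&` B))| < e ->
  `|c - fine (P (U `&` D))| < e -> `|c - fine (P (U `&` B))| < e ->
  fine (P ((U `&` B) `\` D)) + fine (P (D `\` (U `&` B))) <= 10 * e.
Proof.
move=> mD mU mB; rewrite !ltr_norml.
move=> /andP[D1 D2] /andP[DB1 DB2] /andP[UD1 UD2] /andP[UB1 UB2].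
have mUB := measurableI _ _ mU mB.
have E1 := fine_setID mD mU; have E2 := fine_setID mD mB.
rewrite [D `&` U]setIC in E1.
have E3 : fine (P (D `\` (U `&` B))) <= fine (P (D `\` U)) + fine (P (D `\` B)).
  have m1 := measurableD mD mU; have m2 := measurableD mD mB.
  rewrite setDIr -fineD ?fin_num_measure//.
  rewrite fine_le ?fin_num_measure//; [exact: measurableU| |exact: measureU2].
  by rewrite fin_numD !fin_num_measure.
have E4 := fine_setID mUB mD; have E5 := fine_setID mD mUB.
rewrite [D `&` (U `&` B)]setIC in E5.
lra.
Qed.

Lemma fine_markov (u : T -> R) (k : R) : 0 < k -> bmfun u -> (forall x, 0 <= u x) ->
  k * fine (P [set x | k <= u x]) <= \int[P]_x u x.
Proof.
move=> k0 bu u0; have mS : measurable [set x | k <= u x].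
  exact: measurable_fun_ge bu.1.
rewrite -mean_indic// -meanZ; last exact: bmfun_indic.
apply: le_mean => //; first by apply: bmfunZ; exact: bmfun_indic.
move=> x; rewrite indicE; case: (boolP (x \in _)) => [|_].
  by rewrite inE mulr1.
by rewrite mulr0.
Qed.

Lemma bmfun_sum (I : finType) (u : I -> T -> R) : (forall i, bmfun (u i)) ->
  bmfun (fun x => \sum_i u i x).
Proof.
move=> bu; elim: (index_enum I) => [|i s ih].
  by under eq_fun do rewrite big_nil; exact: bmfun_cst.
by under eq_fun do rewrite big_cons; exact: bmfunD.
Qed.

Lemma mean_sum (I : finType) (u : I -> T -> R) : (forall i, bmfun (u i)) ->
  \int[P]_x (\sum_i u i x) = \sum_i \int[P]_x u i x.
Proof.
move=> bu.
have b s : bmfun (fun x => \sum_(i <- s) u i x).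
  elim: s => [|i s ih]; first by under eq_fun do rewrite big_nil; exact: bmfun_cst.
  by under eq_fun do rewrite big_cons; exact: bmfunD.
elim: (index_enum I) => [|i s ih].
  by under eq_Rintegral do rewrite big_nil; rewrite big_nil mean_cst.
by under eq_Rintegral do rewrite big_cons; rewrite big_cons meanD// ih.
Qed.

Lemma le_mean_ae (f g : T -> R) : bmfun f -> bmfun g ->
  (forall x, 0 <= f x) -> (forall x, 0 <= g x) ->
  {ae P, forall x, f x <= g x} -> \int[P]_x f x <= \int[P]_x g x.
Proof.
move=> bf bg f0 g0 fg; rewrite -lee_fin -!mean_EFin//.
apply: ae_ge0_le_integral => //.
- by move=> x _; rewrite lee_fin.
- by apply/measurable_EFinP; exact: bf.1.
- by move=> x _; rewrite lee_fin.
- by apply/measurable_EFinP; exact: bg.1.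
- by apply: filterS fg => x ? _; rewrite lee_fin.
Qed.

End finite_probability.

Section fibers.
Context (R : realType) (G : groupType) (G_countable : countable [set: G]).
Context d (X : measurableType d) (mu : probability X R) (a : mpaction G mu).
Context dZ (Z : measurableType dZ) (eta : probability Z R).
Variable mu_ : Z -> probability X R.
Hypotheses (mu_meas : forall A, measurable A ->
    measurable_fun setT (fun z => mu_ z A))
  (mu_int : forall A, measurable A -> mu A = (\int[eta]_z mu_ z A)%E)
  (mu_inv : {ae eta, forall z, forall g A, measurable A ->
    mu_ z (a g @^-1` A) = mu_ z A}).

Let q (A : set X) (z : Z) : R := fine (mu_ z A).

Let bq A : measurable A -> bmfun (q A).
Proof.
move=> mA; split; first by apply: measurableT_comp => //; exact: mu_meas.
exists 1 => z; have /andP[q0 q1] := fine_measure_itv (mu_ z) mA.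
by rewrite ger0_norm.
Qed.

Let mean_q A : measurable A -> \int[eta]_z q A z = fine (mu A).
Proof.
move=> mA; rewrite mu_int// /Rintegral; congr fine; apply: eq_integral => z _.
by rewrite fineK// fin_num_measure.
Qed.

(** On a fibre the norm of an average is at least its mean, and the squared
   norms on the fibres integrate to the squared norm on the whole space. *)
Lemma fiber_square_le (C : set X) t : measurable C ->
  \int[eta]_z (q C z ^+ 2) <= avg_norm2 a C t.
Proof.
move=> mC.
have mI g h : measurable (a g @^-1` C `&` a h @^-1` C).
  by apply: measurableI; exact: measurable_act_preimage.
have bI g : bmfun (fun z => avg (fun h => q (a g @^-1` C `&` a h @^-1` C) z) t).
  by apply: (bmfun_avg (q := fun h => q (a g @^-1` C `&` a h @^-1` C))) => h; exact: bq.
have -> : avg_norm2 a C t = \int[eta]_z (avg (fun g =>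
    avg (fun h => q (a g @^-1` C `&` a h @^-1` C) z) t) t).
  rewrite (mean_avg eta (q := fun g z => avg (fun h =>
    q (a g @^-1` C `&` a h @^-1` C) z) t))//.
  apply: eq_avg => g.
  rewrite (mean_avg eta (q := fun h => q (a g @^-1` C `&` a h @^-1` C))); last first.
    by move=> h; exact: bq.
  by apply: eq_avg => h; rewrite mean_q.
apply: le_mean_ae.
- by apply: bmfunM; exact: bq.
- by apply: (bmfun_avg (q := fun g z => avg (fun h =>
    q (a g @^-1` C `&` a h @^-1` C) z) t)) => g; exact: bI.
- by move=> z; rewrite sqr_ge0.
- have avg_ge0 (p : G -> R) s : (forall g, 0 <= p g) -> 0 <= avg p s.
    move=> p0; elim: s => [//|t1 h1 t2 h2] /=.
    by rewrite divr_ge0// addr_ge0.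
  by move=> z; apply: (avg_ge0 _ t) => g; apply: (avg_ge0 _ t) => h; rewrite fine_ge0.
- apply: filterS mu_inv => z inv.
  exact: (avg_norm2_ge (Mpaction (act1 a) (actM a) (measurable_act a) inv) mC).
Qed.

Section ergodic_fibers.
Context dE (E : measurableType dE) (nu : probability E R) (e : mpaction G nu).
Hypotheses (e_ergodic : ergodic e) (ea : weakly_contained e a).
Context (I : finType) (A : I -> set E) (mA : forall i, measurable (A i)).
Context (s : seq G).

Let J := ('I_(size s) * I * I)%type.
Let gen (t : J) : G := nth 1%g s t.1.1.

Lemma selfcorrE dY (Y : measurableType dY) (P : probability Y R)
    (b : mpaction G P) C g h : measurable C ->
  selfcorr b C g h = corr b (h * g^-1)%g C C.
Proof.
move=> mC; rewrite /selfcorr /corr; congr fine.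
rewrite -(act_preserves b h^-1%g); last first.
  by apply: measurableI; exact: measurable_act_preimage.
congr (P _); rewrite act_imageE; apply/seteqP; split => x /=;
  by rewrite -!actM invgM invgK mulgV act1.
Qed.

(** Each target intersection [C t] joins the family to be approximated, along
   with the group elements that occur in the norm of an average of its
   translates.  That average is nearly constant by ergodicity, so the average
   of the translates of its approximation [D t] has nearly the norm of a
   constant.  By [fiber_square_le] the measure of [D t] in a fibre then varies
   little with the fibre.  The function [u] adds up this variation and the
   distance from [D t] to the intersection that it stands for. *)
Lemma ergodic_fibers_approx (kappa : R) : 0 < kappa -> forall delta, 0 < delta ->
  exists B : I -> set X, (forall i, measurable (B i)) /\
    exists u : Z -> R, [/\ bmfun u, (forall z, 0 <= u z),
      \int[eta]_z u z <= kappa * delta &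
      forall z, u z < kappa -> forall t : J, exists2 D, measurable D &
      (q D z - corr e (gen t) (A t.1.2) (A t.2)) ^+ 2 < kappa /\
      `|q ((a (gen t) @` B t.1.2) `&` B t.2) z - q D z| < kappa].
Proof.
move=> k0 delta d0.
pose C (t : J) := (e (gen t) @` A t.1.2) `&` A t.2.
pose c (t : J) := corr e (gen t) (A t.1.2) (A t.2).
have mC t : measurable (C t) by apply: measurableI => //; exact: measurable_act_image.
(* One triple contributes at most [14 * eps] to the mean of [u]: [10 * eps]
   from [near_intersection], the rest from the variance. *)
pose eps := kappa * delta / (14 * (#|{: J}|.+1)%:R).
have eps0 : 0 < eps by rewrite divr_gt0 ?mulr_gt0.
have /choice[tr trP] : forall t : J, exists t', avg_norm2 e (C t) t' <= c t ^+ 2 + eps.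
  by move=> t; exact: (mean_ergodic (mC t) G_countable e_ergodic eps0).
pose F : set G := [set 1%g] `|` [set` s] `|`
  \bigcup_(t in [set: J]) [set (p.2 * p.1^-1)%g | p in avg_supp (tr t) `*` avg_supp (tr t)].
have finF : finite_set F.
  rewrite finite_setU; split.
    by rewrite finite_setU; split; [exact: finite_set1|exact: finite_seq].
  apply: bigcup_finite; first exact: finite_finset.
  by move=> t _; apply: finite_image; apply: finite_setX; exact: finite_avg_supp.
have F1 : F 1%g by left; left.
have Fs t : F (gen t) by left; right; rewrite /= /gen mem_nth.
have [B' [mB' AB]] := (weakly_containedP e a).1 ea (I + J)%type
  (fun k => match k with inl i => A i | inr t => C t end) F eps
  (fun k => match k with inl i => mA i | inr t => mC t end) finF eps0.
pose B i := B' (inl i); pose D t := B' (inr t).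
have mB i : measurable (B i) by exact: mB'.
have mD t : measurable (D t) by exact: mB'.
pose V (t : J) := (a (gen t) @` B t.1.2) `&` B t.2.
have mU t : measurable (a (gen t) @` B t.1.2) by exact: measurable_act_image.
have mV t : measurable (V t) by exact: measurableI.
have act1im dY (Y : measurableType dY) (P : probability Y R) (b : mpaction G P)
  S : b 1%g @` S = S.
  by rewrite act_imageE invg1; apply/seteqP; split => x /=; rewrite act1.
have close t : fine (mu (V t `\` D t)) + fine (mu (D t `\` V t)) <= 10 * eps.
  have cE : c t = fine (nu (C t)) by [].
  apply: (near_intersection (c := c t)) => //.
  - by have := AB _ F1 (inr t) (inr t); rewrite /corr !act1im !setIid.
  - have := AB _ F1 (inr t) (inl t.2); rewrite /corr !act1im.
    by rewrite (_ : C t `&` A t.2 = C t)// /C -setIA setIid.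
  - have := AB _ (Fs t) (inl t.1.2) (inr t); rewrite /corr.
    by rewrite (_ : _ `&` C t = C t)// /C setIA setIid.
  - exact: AB _ (Fs t) (inl t.1.2) (inl t.2).
have Dc t : `|c t - fine (mu (D t))| < eps.
  by have := AB _ F1 (inr t) (inr t); rewrite /corr !act1im !setIid.
have norm2 t : avg_norm2 a (D t) (tr t) <= avg_norm2 e (C t) (tr t) + eps.
  rewrite -lerBlDl; apply: le_trans (ler_norm _) _; rewrite distrC.
  apply: avg_dist => g gt; apply: avg_dist => h ht.
  rewrite !selfcorrE//; apply/ltW/(AB _ _ (inr t) (inr t)).
  by right; exists t => //; exists (g, h).
pose u t z := (q (D t) z - c t) ^+ 2 + (q (V t `\` D t) z + q (D t `\` V t) z).
have bu t : bmfun (u t).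
  apply: bmfunD; last by apply: bmfunD; apply: bq; exact: measurableD.
  have : bmfun (fun z => q (D t) z - c t) by apply: bmfunB; [exact: bq|exact: bmfun_cst].
  by move=> b; exact: bmfunM.
have u0 t z : 0 <= u t z by rewrite addr_ge0 ?sqr_ge0// addr_ge0// fine_ge0.
have Iu t : \int[eta]_z u t z <= 14 * eps.
  have b1 : bmfun (fun z => q (D t) z ^+ 2) by apply: bmfunM; exact: bq.
  have b2 : bmfun (fun z => 2 * c t * q (D t) z) by apply: bmfunZ; exact: bq.
  have mVD := measurableD (mV t) (mD t); have mDV := measurableD (mD t) (mV t).
  have -> : \int[eta]_z u t z = \int[eta]_z (((q (D t) z ^+ 2 - 2 * c t * q (D t) z) +
      c t ^+ 2) + (q (V t `\` D t) z + q (D t `\` V t) z)).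
    by apply: eq_Rintegral => z _; rewrite /u; ring.
  rewrite meanD; [|by apply: bmfunD; [exact: bmfunB|exact: bmfun_cst]|
    by apply: bmfunD; exact: bq].
  rewrite (meanD eta (bmfunB b1 b2) (bmfun_cst _ (c t ^+ 2))).
  rewrite (meanB eta b1 b2) (meanZ eta _ (bq (mD t))).
  rewrite (meanD eta (bq mVD) (bq mDV)) !mean_q// mean_cst.
  have := fiber_square_le (tr t) (mD t).
  have /andP[c0 c1] : 0 <= c t <= 1 by exact: (fine_measure_itv nu (mC t)).
  have := norm2 t; have := trP t; have := close t; have := Dc t.
  rewrite ltr_norml => /andP[]; move: (fine (mu (D t))) => m ? ?.
  have : c t * (c t - m) <= eps.
    have [?|?] := leP 0 (c t - m); last by nra.
    by rewrite (le_trans (ler_piMl _ _))// ltW.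
  lra.
exists B; split => //; exists (fun z => \sum_t u t z); split.
- exact: bmfun_sum.
- by move=> z; exact: sumr_ge0.
- rewrite mean_sum//; apply: (@le_trans _ _ (\sum_(t : J) 14 * eps)).
    by apply: ler_sum.
  have E14 : 14 * eps * (#|{: J}|.+1)%:R = kappa * delta.
    have : (#|{: J}|.+1)%:R != 0 :> R by rewrite pnatr_eq0.
    by rewrite /eps; move: (_%:R) => m m0; field.
  rewrite sumr_const -[leLHS]mulr_natr -E14 ler_pM2l ?mulr_gt0// ler_nat.
  exact: leqnSn.
- move=> z uz t; exists (D t) => //.
  have utk : u t z < kappa.
    apply: le_lt_trans uz; rewrite (bigD1 t)//= lerDl.
    by apply: sumr_ge0.
  have h0 : 0 <= q (V t `\` D t) z + q (D t `\` V t) z.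
    by rewrite addr_ge0// fine_ge0.
  split; first by apply: le_lt_trans utk; rewrite lerDl.
  apply: le_lt_trans (fine_measure_dist (mu_ z) (mV t) (mD t)) _.
  by apply: le_lt_trans utk; rewrite lerDr sqr_ge0.
Qed.

(** By Markov's inequality [ergodic_fibers_approx] works outside a set of fibres
   of measure [delta], for every [delta]. *)
Lemma ergodic_fibers (eps : R) : 0 < eps ->
  {ae eta, forall z, exists B : I -> set X, (forall i, measurable (B i)) /\
    forall g, g \in s -> forall i j,
      `|corr e g (A i) (A j) - q ((a g @` B i) `&` B j) z| < eps}.
Proof.
move=> eps0.
(* [kappa] and its square root are at most [eps / 2] *)
pose kappa := Num.min (eps / 2) ((eps / 2) ^+ 2).
have k0 : 0 < kappa by rewrite lt_min divr_gt0// exprn_gt0// divr_gt0.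
have /choice[B BP] n := ergodic_fibers_approx k0 (delta := n.+1%:R^-1) ltac:(by rewrite invr_gt0).
have /choice[u uP] n := (BP n).2.
pose S n := [set z | kappa <= u n z].
have mS n : measurable (S n).
  have [bu _ _ _] := uP n.
  exact: measurable_fun_ge bu.1.
have mSn : measurable (\bigcap_n S n) by exact: bigcap_measurableType.
exists (\bigcap_n S n); split => //.
- apply/eqP; rewrite eq_le measure_ge0 andbT.
  rewrite -[X in (X <= _)%E]fineK ?fin_num_measure// lee_fin.
  apply/ler_addgt0Pl => d' d'0; rewrite addr0.
  pose n := Num.truncn d'^-1.
  apply: (@le_trans _ _ n.+1%:R^-1); last first.
    by rewrite -[leRHS]invrK lef_pV2 ?posrE ?invr_gt0// ltW// truncnS_gt.
  apply: (@le_trans _ _ (fine (eta (S n)))).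
    by apply: fine_le_measure => //; exact: bigcap_inf.
  have [bu u0 Iu _] := uP n.
  by rewrite -(ler_pM2l k0) (le_trans (fine_markov _ _ _ _)).
- move=> z /= nB n _ /=; rewrite /S/= leNgt; apply/negP => unk; apply: nB.
  exists (B n); split; first exact: (BP n).1.
  have [_ _ _ H] := uP n.
  move=> g gs i j.
  have gi : (index g s < size s)%N by rewrite index_mem.
  have [D mD [D1 D2]] := H z unk (Ordinal gi, i, j).
  move: D1 D2; rewrite /gen/= nth_index// distrC.
  set c := corr _ _ _ _; set qD := q D z; set qV := q _ z => D1 D2.
  have cD : `|c - qD| < eps / 2.
    rewrite -ltr_sqr ?nnegrE ?normr_ge0 ?divr_ge0 ?ltW// real_normK ?num_real//.
    rewrite -sqrrN opprB; apply: lt_le_trans D1 _.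
    by rewrite ge_min lexx orbT.
  have DV : `|qD - qV| < eps / 2.
    by apply: lt_le_trans D2 _; rewrite ge_min lexx.
  rewrite [ltRHS]splitr; apply: le_lt_trans (ler_distD qD _ _) _.
  exact: ltrD.
Qed.

End ergodic_fibers.
End fibers.

(** * Countably many sets and patterns that determine weak containment *)

(** Joint denial is the only connective: it generates all Boolean operations
   and keeps the set of terms evidently countable. *)
Inductive boolean_term := Atom of rat | Nor of boolean_term & boolean_term.

Fixpoint boolean_term_tree (t : boolean_term) : GenTree.tree rat :=
  match t with
  | Atom r => GenTree.Leaf r
  | Nor t1 t2 => GenTree.Node 0 [:: boolean_term_tree t1; boolean_term_tree t2]
  end.

Lemma countable_boolean_term : countable [set: boolean_term].
Proof.
apply/countable_injP; exists (fun t => pickle (boolean_term_tree t)).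
move=> t t' _ _ /(pcan_inj pickleK).
elim: t t' => [r|t1 h1 t2 h2] [r'|t1' t2'] //= [].
  by move=> ->.
by move=> /h1 -> /h2 ->.
Qed.

Section symdiff.
Context (R : realType) d (T : measurableType d) (P : probability T R).

Definition symdiff (A B : set T) : set T := (A `\` B) `|` (B `\` A).

Definition symdist (A B : set T) : R := fine (P (symdiff A B)).

Lemma measurable_symdiff A B : measurable A -> measurable B ->
  measurable (symdiff A B).
Proof. by move=> mA mB; apply: measurableU; exact: measurableD. Qed.

Lemma le_symdist A B (D : set T) : measurable A -> measurable B -> measurable D ->
  (forall x, A x -> ~ B x -> D x) -> (forall x, B x -> ~ A x -> D x) ->
  symdist A B <= fine (P D).
Proof.
move=> mA mB mD AD BD; apply: fine_le_measure => //.
  exact: measurable_symdiff.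
by move=> x [[Ax nBx]|[Bx nAx]]; [exact: AD|exact: BD].
Qed.

Lemma fine_measureU2 A B : measurable A -> measurable B ->
  fine (P (A `|` B)) <= fine (P A) + fine (P B).
Proof.
move=> mA mB; rewrite -fineD ?fin_num_measure//.
rewrite fine_le ?fin_num_measure//; [exact: measurableU| |exact: measureU2].
by rewrite fin_numD !fin_num_measure.
Qed.

Lemma dist_symdist A B : measurable A -> measurable B ->
  `|fine (P A) - fine (P B)| <= symdist A B.
Proof.
move=> mA mB; rewrite (le_trans (fine_measure_dist P mA mB))//.
have mAB := measurableD mA mB; have mBA := measurableD mB mA.
rewrite -fineD ?fin_num_measure// /symdist /symdiff measureU//.
by apply/seteqP; split => // x [[? ?] []].
Qed.

Lemma symdist_triangle A B C : measurable A -> measurable B -> measurable C ->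
  symdist A C <= symdist A B + symdist B C.
Proof.
move=> mA mB mC; have mAB := measurable_symdiff mA mB.
have mBC := measurable_symdiff mB mC.
apply: le_trans (fine_measureU2 mAB mBC).
apply: le_symdist => //; first exact: measurableU.
- move=> x Ax nCx; have [Bx|nBx] := pselect (B x); first by right; left.
  by left; left.
- move=> x Cx nAx; have [Bx|nBx] := pselect (B x); first by left; right.
  by right; right.
Qed.

Lemma symdistC A B : measurable A -> measurable B -> symdist (~` A) (~` B) = symdist A B.
Proof.
move=> mA mB; congr (fine (P _)); apply/seteqP.
split => x [[h1 h2]|[h1 h2]].
- by right; split => //; exact: contrapT.
- by left; split => //; exact: contrapT.
- by right; split => //; exact.
- by left; split => //; exact.
Qed.

Lemma symdistU A A' B B' : measurable A -> measurable A' -> measurable B ->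
  measurable B' -> symdist (A `|` A') (B `|` B') <= symdist A B + symdist A' B'.
Proof.
move=> mA mA' mB mB'.
have mAB := measurable_symdiff mA mB; have mAB' := measurable_symdiff mA' mB'.
apply: le_trans (fine_measureU2 mAB mAB').
apply: le_symdist; [exact: measurableU|exact: measurableU|exact: measurableU| |].
- move=> x [Ax|A'x] nBB.
    by left; left; split => // Bx; apply: nBB; left.
  by right; left; split => // Bx; apply: nBB; right.
- move=> x [Bx|B'x] nAA.
    by left; right; split => // Ax; apply: nAA; left.
  by right; right; split => // Ax; apply: nAA; right.
Qed.

End symdiff.

Section dense.
Context (R : realType) d (X : measurableType d).
Variables (phi : X -> R) (g : R -> X).
Hypotheses (mphi : measurable_fun setT phi) (mg : measurable_fun setT g)
  (phiK : cancel phi g).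

Fixpoint boolean_set (t : boolean_term) : set X :=
  match t with
  | Atom r => [set x | ratr r < phi x]
  | Nor t1 t2 => ~` (boolean_set t1 `|` boolean_set t2)
  end.

Let mray (r : R) : measurable [set x | r < phi x].
Proof.
rewrite [X in measurable X](_ : _ = phi @^-1` `]r, +oo[).
  by rewrite -[X in measurable X]setTI; apply: mphi.
by apply/seteqP; split => x /=; rewrite in_itv/= andbT.
Qed.

Lemma measurable_boolean_set t : measurable (boolean_set t).
Proof.
elim: t => [r|t1 h1 t2 h2] /=; first exact: mray.
by apply: measurableC; exact: measurableU.
Qed.

(** The sets that can be approximated form a sigma-algebra, which contains the
   preimages of all rays, hence everything because [phi] has a Borel left
   inverse. *)
Lemma boolean_set_dense (P : probability X R) A : measurable A ->
  forall e : R, 0 < e -> exists t, symdist P A (boolean_set t) < e.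
Proof.
pose approx A := measurable A /\ forall e : R, 0 < e -> exists t, symdist P A (boolean_set t) < e.
have approxC B : approx B -> approx (~` B).
  move=> [mB aB]; split; first exact: measurableC.
  move=> e e0; have [t te] := aB e e0; exists (Nor t t).
  by rewrite /= setUid symdistC//; exact: measurable_boolean_set.
have approxU B C : approx B -> approx C -> approx (B `|` C).
  move=> [mB aB] [mC aC]; split; first exact: measurableU.
  move=> e e0; have e20 : 0 < e / 2 by rewrite divr_gt0.
  have [t te] := aB _ e20; have [t' t'e] := aC _ e20.
  exists (Nor (Nor t t') (Nor t t')); rewrite /= setUid setCK [ltRHS]splitr.
  have [mt mt'] := (measurable_boolean_set t, measurable_boolean_set t').
  by rewrite (le_lt_trans (symdistU P mB mC mt mt'))// ltrD.
have approx0 : approx set0.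
  split => // e e0; exists (Nor (Atom 0) (Nor (Atom 0) (Atom 0))).
  rewrite /= /symdist /symdiff setUid setUv setCT setD0 setUid measure0//.
have approx_bigcup (F : nat -> set X) : (forall n, approx (F n)) ->
    approx (\bigcup_n F n).
  move=> aF; have mF n : measurable (F n) by case: (aF n).
  have mU : measurable (\bigcup_n F n) by exact: bigcup_measurable.
  split => // e e0; have e20 : 0 < e / 2 by rewrite divr_gt0.
  pose H n := \big[setU/set0]_(i < n) F i.
  have aH n : approx (H n).
    rewrite /H; elim: n => [|n ih]; first by rewrite big_ord0.
    by rewrite big_ord_recr/=; exact: approxU.
  have mH n : measurable (H n) by case: (aH n).
  have UH : \bigcup_n H n = \bigcup_n F n.
    apply/seteqP; split => x [n _].
      by rewrite /H => /mem_set; rewrite -bigcup_mkord inE => -[i _ Fx]; exists i.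
    by move=> Fx; exists n.+1 => //; rewrite /H big_ord_recr/=; right.
  have cv : P (H n) @[n --> \oo] --> P (\bigcup_n F n).
    rewrite -UH; apply: nondecreasing_cvg_mu => //; first by rewrite UH.
    by move=> m n mn; apply/subsetPset; exact: subset_bigsetU.
  have cvr : fine (P (H n)) @[n --> \oo] --> fine (P (\bigcup_n F n)).
    by apply: fine_cvg; rewrite fineK// fin_num_measure.
  have [n Hn] : exists n, fine (P (\bigcup_n F n)) - e / 2 < fine (P (H n)).
    have lt : fine (P (\bigcup_n F n)) - e / 2 < fine (P (\bigcup_n F n)).
      by rewrite ltrBlDr ltrDl.
    by have [n _ Hn] := cvgr_gt _ cvr _ lt; exists n; exact: (Hn n (leqnn _)).
  have HU : H n `<=` \bigcup_n F n by rewrite -UH; exact: bigcup_sup.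
  have [t te] := (aH n).2 _ e20; exists t.
  rewrite [ltRHS]splitr; apply: le_lt_trans (symdist_triangle P mU (mH n) (measurable_boolean_set t)) _.
  apply: ltrD => //; rewrite /symdist /symdiff.
  rewrite (_ : H n `\` _ = set0) ?setU0; last by rewrite setD_eq0.
  by have := fine_setID P mU (mH n); rewrite (setIidr HU); move: Hn; lra.
have approx_ray r : approx [set x | r < phi x].
  have [s sQ] := countable_enum (0 : rat) (countableP [set: rat]).
  have -> : [set x | r < phi x] = \bigcup_n
      (if r <= ratr (s n) then boolean_set (Atom (s n)) else set0).
    apply/seteqP; split => x /=.
      move=> /rat_in_itvoo[p]; rewrite in_itv/= => /andP[rp px].
      by have [n np] := sQ p Logic.I; exists n => //; rewrite np (ltW rp).
    by move=> [n _]; case: ifPn => //= rs; exact: le_lt_trans.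
  apply: approx_bigcup => n; case: ifPn => // _.
  split; first exact: mray.
  move=> e e0; exists (Atom (s n)); rewrite /symdist /symdiff setDv setUid measure0//.
move=> mA; suff [] : approx A by [].
have -> : A = phi @^-1` (g @^-1` A) by apply/seteqP; split => x /=; rewrite phiK.
have : (@RGenOInfty.G R).-sigma.-measurable (g @^-1` A).
  by rewrite -RGenOInfty.measurableE -[X in measurable X]setTI; exact: mg.
apply: (smallest_sub (X := [set B | approx (phi @^-1` B)])).
  split => /=.
  - by rewrite preimage_set0.
  - by move=> B aB; rewrite setTD preimage_setC; exact: approxC.
  - by move=> F aF; rewrite preimage_bigcup; exact: approx_bigcup.
move=> _ [r ->] /=.
rewrite (_ : phi @^-1` _ = [set x | r < phi x]); first exact: approx_ray.
by apply/seteqP; split => x /=; rewrite in_itv/= andbT.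
Qed.

End dense.

Lemma countable_dense (R : realType) d (X : measurableType d) (x0 : X) :
  standard_borel R X ->
  exists D : nat -> set X, (forall n, measurable (D n)) /\
    forall (P : probability X R) A, measurable A ->
      forall e : R, 0 < e -> exists n, symdist P A (D n) < e.
Proof.
move=> sX; have [phi [g [mphi mg phiK]]] := standard_borel_embedding x0 sX.
have [s sT] := countable_enum (Atom 0) countable_boolean_term.
exists (fun n => boolean_set phi (s n)); split; first by move=> n; exact: measurable_boolean_set.
move=> P A mA e e0; have [t te] := boolean_set_dense mphi mg phiK P mA e0.
by have [n tn] := sT t Logic.I; exists n; rewrite tn.
Qed.

(** Correlations are continuous in the sets, so that arbitrary measurable sets
   may be replaced by members of a dense sequence. *)
Lemma corr_symdist (R : realType) (G : groupType) d (T : measurableType d)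
    (P : probability T R) (a : mpaction G P) g A B A' B' :
  measurable A -> measurable B -> measurable A' -> measurable B' ->
  `|corr a g A B - corr a g A' B'| <= symdist P A A' + symdist P B B'.
Proof.
move=> mA mB mA' mB'.
have mgA := measurable_act_image a g mA; have mgA' := measurable_act_image a g mA'.
rewrite /corr; apply: le_trans (dist_symdist _ _ _) _; [exact: measurableI..|].
have -> : symdist P A A' = fine (P (a g @` symdiff A A')).
  by rewrite act_image_preserves//; exact: measurable_symdiff.
have mS := measurable_act_image a g (measurable_symdiff mA mA').
have mS' := measurable_symdiff mB mB'.
apply: le_trans (fine_measureU2 P mS mS').
apply: le_symdist; [exact: measurableI|exact: measurableI|exact: measurableU| |];
  rewrite !act_imageE => x /= [Ax Bx] nAB.
- have [A'x|nA'x] := pselect (A' (a g^-1%g x)).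
    by right; left; split => // B'x; apply: nAB.
  by left; left.
- have [A'x|nA'x] := pselect (A (a g^-1%g x)).
    by right; right; split => // B'x; apply: nAB.
  by left; right.
Qed.

Section patterns.
Context (R : realType) (G : groupType) (s : nat -> G).
Hypothesis sG : forall g, exists n, s n = g.

(** The correlations of finitely many sets under finitely many group elements,
   rounded to multiples of [N.+1^-1]. *)
Definition pattern d (T : measurableType d) (P : probability T R)
    (b : mpaction G P) N (B : 'I_N -> set T) (M : 'I_N * 'I_N * 'I_N -> nat)
    (c : R) : Prop :=
  forall k i j : 'I_N, `|corr b (s k) (B i) (B j) - (M (k, i, j))%:R / N.+1%:R| <
    c / N.+1%:R.

(** A finite family is approximated by terms of the dense sequence [D], and its
   correlations by fractions with a large denominator; this reduces weak
   containment to countably many conditions on the source. *)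
Lemma weakly_contained_patterns d1 (T1 : measurableType d1)
    (P1 : probability T1 R) d2 (T2 : measurableType d2) (P2 : probability T2 R)
    (b1 : mpaction G P1) (b2 : mpaction G P2) (D : nat -> set T1) :
  (forall n, measurable (D n)) ->
  (forall A, measurable A -> forall e : R, 0 < e -> exists n, symdist P1 A (D n) < e) ->
  (forall N (t : {ffun 'I_N -> nat}) (M : {ffun 'I_N * 'I_N * 'I_N -> nat}),
    pattern b1 (fun i => D (t i)) M 1 ->
    exists2 B : 'I_N -> set T2, (forall i, measurable (B i)) & pattern b2 B M 3) ->
  weakly_contained b1 b2.
Proof.
move=> mD dD pat; apply/weakly_containedP => I A F e mA finF e0.
have [l Fl] := (finite_seqP F).1 finF.
have /choice[idx sidx] := sG.
have e8 : 0 < e / 8 by rewrite divr_gt0.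
have /choice[n nP] i := dD _ (mA i) _ e8.
pose N1 := \max_(g <- l) (idx g).+1.
pose N := (N1 + (#|I| + Num.truncn (e / 8)^-1))%N.
have N1e : N.+1%:R^-1 < e / 8 :> R.
  rewrite -[ltRHS]invrK ltf_pV2 ?posrE ?invr_gt0//.
  apply: (lt_le_trans (truncnS_gt _)); by rewrite ler_nat ltnS /N addnA leq_addl.
have IN : (#|I| <= N)%N by rewrite /N addnCA leq_addr.
pose inj (i : I) : 'I_N := widen_ord IN (enum_rank i).
pose t : {ffun 'I_N -> nat} := [ffun r : 'I_N =>
  if insub (r : nat) is Some r' then n (enum_val (r' : 'I_#|I|)) else 0%N].
have tE i : t (inj i) = n i.
  by rewrite ffunE /inj/= valK enum_rankK.
pose M : {ffun 'I_N * 'I_N * 'I_N -> nat} := [ffun k : 'I_N * 'I_N * 'I_N =>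
  Num.truncn (corr b1 (s k.1.1) (D (t k.1.2)) (D (t k.2)) * N.+1%:R)].
have N0 : 0 < N.+1%:R :> R by [].
have pM : pattern b1 (fun i => D (t i)) M 1.
  move=> k i j; set x := corr _ _ _ _.
  have -> : M (k, i, j) = Num.truncn (x * N.+1%:R) by rewrite /M ffunE.
  have x0 : 0 <= x * N.+1%:R by rewrite mulr_ge0// fine_ge0.
  have /andP[m1 m2] := truncn_itv x0.
  rewrite ltr_norml.
  have : 0 < N.+1%:R^-1 :> R by rewrite invr_gt0.
  move: m1 m2; rewrite -[X in _ < X]natr1 -ler_pdivrMr// -ltr_pdivlMr// mulrDl.
  rewrite div1r; move: (_%:R / _) => m; move: (_^-1) => iN *.
  by apply/andP; split; lra.
have [B mB pB] := pat N t M pM.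
exists (fun i => B (inj i)); split => // g Fg i j.
have gN : (idx g < N)%N.
  apply: (@leq_trans N1); last by rewrite /N leq_addr.
  have gl : g \in l by move: Fg; rewrite Fl.
  by rewrite /N1 (leq_bigmax_seq (F := fun g => (idx g).+1)).
have := pM (Ordinal gN) (inj i) (inj j); have := pB (Ordinal gN) (inj i) (inj j).
rewrite /= sidx !tE; move: (_%:R / _) => m.
have := corr_symdist b1 g (mA i) (mA j) (mD (n i)) (mD (n j)).
have := nP i; have := nP j.
set x1 := corr _ _ (A i) _; set x2 := corr _ _ (D _) _; set x3 := corr _ _ _ _.
move: N1e; set iN := N.+1%:R^-1 => N1e h1 h2 h3.
rewrite !mul1r !ltr_norml => /andP[? ?] /andP[? ?].
move: h3; rewrite ler_norml => /andP[? ?].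
by apply/andP; split; lra.
Qed.

End patterns.

Section disintegration.
Context (R : realType) d (X : measurableType d) (mu : probability X R).
Context dZ (Z : measurableType dZ) (eta : probability Z R) (pi : X -> Z).
Variable mu_ : Z -> probability X R.
Hypotheses (Z_set1 : forall z : Z, measurable [set z])
  (pi_meas : measurable_fun setT pi)
  (mu_meas : forall A, measurable A ->
    measurable_fun setT (fun z => mu_ z A))
  (mu_int : forall A, measurable A -> mu A = (\int[eta]_z mu_ z A)%E)
  (mu_fiber : {ae eta, forall z, mu_ z (pi @^-1` [set z]) = 1%E}).

Lemma measurable_pi_preimage W : measurable W -> measurable (pi @^-1` W).
Proof. by move=> mW; rewrite -[X in measurable X]setTI; exact: pi_meas. Qed.

Lemma fiber_setI_preimage S W : measurable S -> measurable W ->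
  {ae eta, forall z, fine (mu_ z (S `&` pi @^-1` W)) = \1_W z * fine (mu_ z S)}.
Proof.
move=> mS mW; have mpW := measurable_pi_preimage mW.
apply: filterS mu_fiber => z z1.
have mz := measurable_pi_preimage (Z_set1 z).
have aez : {ae mu_ z, forall x, pi x = z} by exact: (measure1_ae mz z1).
rewrite indicE; have [Wz|nWz] := pselect (W z).
  rewrite mem_set// mul1r; congr fine; apply: ae_eq_set_measure => //.
    exact: measurableI.
  by apply: filterS aez => x /= ->; split => [[]|].
have -> : mu_ z (S `&` pi @^-1` W) = mu_ z set0.
  apply: ae_eq_set_measure => //; first exact: measurableI.
  by apply: filterS aez => x /= ->; split => [[]|].
by rewrite memNset// mul0r measure0.
Qed.

(** The measure [mu_ z] lives on the fibre of [z], so [S] meets the preimage of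
   [W] in [mu_ z S] if [z] is in [W] and in nothing otherwise. *)
Lemma disintegration_average S W (m c : R) : measurable S -> measurable W ->
  (forall z, W z -> `|fine (mu_ z S) - m| <= c) ->
  `|fine (mu (S `&` pi @^-1` W)) - m * fine (eta W)| <= c * fine (eta W).
Proof.
move=> mS mW Sm; have mpW := measurable_pi_preimage mW.
have mSW : measurable (S `&` pi @^-1` W) by exact: measurableI.
have bq A : measurable A -> bmfun (fun z => fine (mu_ z A)).
  move=> mA; split; first by apply: measurableT_comp => //; exact: mu_meas.
  exists 1 => z; have /andP[q0 q1] := fine_measure_itv (mu_ z) mA.
  by rewrite ger0_norm.
have b1 := @bmfun_indic R _ Z W mW.
have bS : bmfun (fun z => \1_W z * fine (mu_ z S)).
  by apply: bmfunM => //; exact: bq.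
have ge0 A z : 0 <= fine (mu_ z A) by rewrite fine_ge0.
have ge0' z : 0 <= \1_W z * fine (mu_ z S) by rewrite mulr_ge0.
have -> : fine (mu (S `&` pi @^-1` W)) = \int[eta]_z (\1_W z * fine (mu_ z S)).
  transitivity (\int[eta]_z (fine (mu_ z (S `&` pi @^-1` W)))).
    rewrite mu_int// /Rintegral; congr fine; apply: eq_integral => z _.
    by rewrite fineK// fin_num_measure.
  have H := fiber_setI_preimage mS mW.
  apply/eqP; rewrite eq_le; apply/andP; split; apply: le_mean_ae => //;
    try exact: bq; by apply: filterS H => z ->.
rewrite -mean_indic// -!meanZ// -meanB//; last exact: bmfunZ.
have bZ : bmfun (fun z => \1_W z * fine (mu_ z S) - m * \1_W z).
  by apply: bmfunB => //; exact: bmfunZ.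
apply: le_trans (le_normr_Rintegral _ _) _ => //; first exact: bmfun_integrable.
apply: le_mean; [exact: bmfun_norm|exact: bmfunZ|] => z.
rewrite indicE; have [Wz|nWz] := pselect (W z).
  by rewrite mem_set// mul1r !mulr1; exact: Sm.
by rewrite memNset// mul0r !mulr0 subr0 normr0.
Qed.

End disintegration.

(** * Almost all ergodic components are weakly equivalent *)

Section components.
Context (R : realType) (G : groupType) (G_countable : countable [set: G]).
Context d (X : measurableType d) (mu : probability X R).
Hypotheses (X_standard : standard_borel R X) (mu_nonatomic : nonatomic mu).
Context (a : mpaction G mu) (a_extreme : extreme_point (weq_class a)).
Context dZ (Z : measurableType dZ) (eta : probability Z R).
Hypothesis Z_standard : standard_borel R Z.
Context (pi : X -> Z) (mu_ : Z -> pprobability X R)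
  (a_ : forall z : Z, mpaction G (mu_ z)).
Hypothesis a_dec : ergodic_decomposition a eta pi a_.
Variables (s : nat -> G) (D : nat -> set X).
Hypotheses (sG : forall g, exists n, s n = g) (mD : forall n, measurable (D n))
  (dD : forall (P : probability X R) A, measurable A ->
      forall e : R, 0 < e -> exists n, symdist P A (D n) < e).

Let mu_meas A : measurable A -> measurable_fun setT (fun z => mu_ z A).
Proof.
move=> mA.
exact: (measurable_kernel (kprobability (edec_kernel a_dec)) A mA).
Qed.

Let fiber_eq : {ae eta, forall z, forall g A, measurable A ->
  {ae mu_ z, forall x, A (a_ z g x) <-> A (a g x)}}.
Proof.
apply: filterS (edec_restriction a_dec) => z az g A mA.
by apply: filterS (az g) => x ->.
Qed.

Let fiber_corr : {ae eta, forall z, forall g A B, measurable A -> measurable B ->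
  corr (a_ z) g A B = fine (mu_ z ((a g @` A) `&` B))}.
Proof.
apply: filterS fiber_eq => z az g A B mA mB; congr fine.
apply: ae_eq_set_measure.
- by apply: measurableI => //; exact: measurable_act_image.
- by apply: measurableI => //; exact: measurable_act_image.
- by rewrite !act_imageE; apply: filterS (az g^-1%g A mA) => x /= ->.
Qed.

Let fiber_inv : {ae eta, forall z, forall g A, measurable A ->
  mu_ z (a g @^-1` A) = mu_ z A}.
Proof.
apply: filterS fiber_eq => z az g A mA.
rewrite -[RHS](act_preserves (a_ z) g)//; apply: ae_eq_set_measure.
- exact: measurable_act_preimage.
- exact: measurable_act_preimage.
- by apply: filterS (az g A mA) => x /= ->.
Qed.

(** Countability of this type allows one to discard a null set of fibres for
   every pattern. *)
Let code := {N : nat &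
  ({ffun 'I_N -> nat} * {ffun 'I_N * 'I_N * 'I_N -> nat})%type}.

Let has_code (c : code) : set Z :=
  [set z | pattern s (a_ z) (fun i => D ((tagged c).1 i)) (tagged c).2 1].

(** Equal to [has_code c] up to a null set, but defined with the action [a] in
   place of the [a_ z], which need not depend measurably on [z]. *)
Let cell (c : code) : set Z := [set z | forall t : 'I_(tag c) * 'I_(tag c) * 'I_(tag c),
  `|fine (mu_ z ((a (s t.1.1) @` D ((tagged c).1 t.1.2)) `&` D ((tagged c).1 t.2))) -
    ((tagged c).2 t)%:R / (tag c).+1%:R| < 1 / (tag c).+1%:R].

Let measurable_cell c : measurable (cell c).
Proof.
rewrite [X in measurable X](_ : _ = \bigcap_(t in [set: 'I_(tag c) * 'I_(tag c) * 'I_(tag c)])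
  [set z | `|fine (mu_ z ((a (s t.1.1) @` D ((tagged c).1 t.1.2)) `&` D ((tagged c).1 t.2))) -
    ((tagged c).2 t)%:R / (tag c).+1%:R| < 1 / (tag c).+1%:R]); last first.
  by apply/seteqP; split => z h t; [move=> _; exact: h|exact: (h t Logic.I)].
apply: fin_bigcap_measurable => [|t _]; first exact: finite_finset.
set S := _ `&` _; set m := _ / _; set r := 1 / _.
have mS : measurable S by apply: measurableI => //; exact: measurable_act_image.
rewrite [X in measurable X](_ : _ =
    (fun z => `|fine (mu_ z S) - m|) @^-1` `]-oo, r[); last first.
  by apply/seteqP; split => z /=; rewrite in_itv.
have mf : measurable_fun setT (fun z => `|fine (mu_ z S) - m|).
  apply: measurableT_comp => //; apply: measurable_funB => //.
  by apply: measurableT_comp => //; exact: mu_meas.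
by rewrite -[X in measurable X]setTI; exact: (mf measurableT).
Qed.

Let cell_code : {ae eta, forall z, forall c, cell c z <-> has_code c z}.
Proof.
apply: filterS fiber_corr => z zc c; split => [zcell k i j|zcode [[k i] j]].
  by rewrite zc//; exact: (zcell (k, i, j)).
by have := zcode k i j; rewrite zc.
Qed.

Let countable_code : countable [set: code].
Proof. exact: countableP. Qed.

Let cell_positive : {ae eta, forall z, forall c, cell c z -> (0 < eta (cell c))%E}.
Proof.
apply: ae_forall_countable => // c.
have [c0|c0] := eqVneq (eta (cell c)) 0%E.
  exists (cell c); split; [exact: measurable_cell|exact: c0|].
  by move=> z /= /not_implyP[].
by apply: aeW => z _; rewrite lt_def c0 measure_ge0.
Qed.

(** The restriction of [a] to the fibres over a cell of positive measure is
   weakly contained in [a] by extremality, so the pattern of the cell, which is an average over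
   it, occurs in [a]. *)
Let cell_pattern c : (0 < eta (cell c))%E ->
  exists2 B : 'I_(tag c) -> set X, (forall i, measurable (B i)) &
    pattern s a B (tagged c).2 3.
Proof.
move=> c0; have mc := measurable_cell c.
have mpi := edec_measurable a_dec.
pose E := pi @^-1` cell c.
have mE : measurable E by rewrite -[X in measurable X]setTI; exact: mpi.
have muE : mu E = eta (cell c) by exact: (edec_pushforward a_dec).
have E0 : (0 < mu E)%E by rewrite muE.
have aE g : {ae mu, forall x, E (a g x) <-> E x}.
  by apply: filterS (edec_invariant a_dec g) => x px; rewrite /E /= px.
have /weakly_containedP wc := extreme_restriction G_countable X_standard mu_nonatomic mE E0 aE a_extreme.
pose F : set G := s @` [set k | (k < tag c)%N].
have finF : finite_set F by apply: finite_image; exact: finite_II.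
have d0 : 0 < (tag c).+1%:R^-1 :> R by rewrite invr_gt0.
have [B [mB wB]] := wc _ (fun i => D ((tagged c).1 i)) F _ (fun i => mD _) finF d0.
exists B => // k i j.
have Fk : F (s k) by exists (k : nat) => //; exact: (ltn_ord k).
have := wB _ Fk i j.
have mS : measurable ((a (s k) @` D ((tagged c).1 i)) `&` D ((tagged c).1 j)).
  by apply: measurableI => //; exact: measurable_act_image.
set S := (_ `&` _) in mS.
have := disintegration_average (standard_borel_set1 Z_standard) mpi mu_meas
  (edec_disintegration a_dec) (edec_fiber a_dec) mS mc
  (m := ((tagged c).2 (k, i, j))%:R / (tag c).+1%:R) (c := 1 / (tag c).+1%:R)
  (fun z zc => ltW (zc (k, i, j))).
rewrite -/E -muE.
have -> : fine (mu (S `&` E)) = fine (mu E) * corr (restrict_act mE E0 aE) (s k)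
    (D ((tagged c).1 i)) (D ((tagged c).1 j)).
  by rewrite -(condM mE E0 mS) fineM// ?fin_num_measure.
have E0' := fine_measure_gt0 mE E0.
rewrite [_ * fine (mu E)]mulrC -mulrBr normrM (gtr0_norm E0') mulrC ler_pM2r//.
set x := corr _ _ _ _; set y := corr _ _ _ _; set m := _%:R / _.
rewrite [1 / _]mul1r; move: d0; move: (_.+1%:R^-1) => iN iN0.
rewrite ler_norml !ltr_norml => /andP[? ?] /andP[? ?].
by apply/andP; split; lra.
Qed.

Let contained_whole : {ae eta, forall z, weakly_contained (a_ z) a}.
Proof.
apply: filterS2 cell_positive cell_code => z zpos zcode.
apply: (weakly_contained_patterns sG mD); first exact: dD.
move=> N t M pat.
pose c : code := existT _ N (t, M).
have zc : cell c z by apply/zcode.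
exact: cell_pattern (zpos _ zc).
Qed.

(** By ergodicity of a single fibre whose pattern it is, a pattern of positive
   probability occurs in almost every fibre. *)
Let cell_pattern_ae c : (0 < eta (cell c))%E ->
  {ae eta, forall z, exists2 B : 'I_(tag c) -> set X,
    (forall i, measurable (B i)) & pattern s (a_ z) B (tagged c).2 3}.
Proof.
move=> c0.
have [z1 [z1c z1code z1erg z1a]] : exists z, [/\ cell c z, has_code c z,
    ergodic (a_ z) & weakly_contained (a_ z) a].
  apply: contrapT => no.
  have : {ae eta, forall z, ~ cell c z}.
    apply: filterS3 cell_code (edec_ergodic a_dec) contained_whole.
    move=> z zcode zerg za zc; apply: no; exists z; split => //.
    by apply/zcode.
  move=> [N [mN N0 sN]].
  have : (eta (cell c) <= 0)%E.
    rewrite -[X in (_ <= X)%E]N0; apply: le_measure; rewrite ?inE//.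
    by move=> z zc; apply: sN => /(_ zc).
  by rewrite leNgt c0.
pose l := [seq s k | k <- iota 0 (tag c)].
have d0 : 0 < (tag c).+1%:R^-1 :> R by rewrite invr_gt0.
have H := ergodic_fibers G_countable mu_meas (edec_disintegration a_dec) fiber_inv
  z1erg z1a (A := fun i => D ((tagged c).1 i)) (fun i => mD _) l d0.
apply: filterS2 fiber_corr H => z zcorr [B [mB BP]].
exists B => // k i j.
have kl : s k \in l by apply/mapP; exists (k : nat) => //; rewrite mem_iota/=.
have := BP _ kl i j; have := z1code k i j; rewrite zcorr//.
set x := corr _ _ _ _; set y := fine _; set m := _%:R / _.
rewrite [1 / _]mul1r; move: d0; move: (_.+1%:R^-1) => iN iN0.
rewrite !ltr_norml => /andP[? ?] /andP[? ?].
by apply/andP; split; lra.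
Qed.

(** Outside a null set, every fibre realises exactly those patterns, up to
   rounding, whose cells have positive measure. *)
Lemma components_weakly_equivalent :
  exists z0, {ae eta, forall z, weakly_equivalent (a_ z) (a_ z0)}.
Proof.
have pat : {ae eta, forall z, forall c, (0 < eta (cell c))%E ->
    exists2 B : 'I_(tag c) -> set X,
      (forall i, measurable (B i)) & pattern s (a_ z) B (tagged c).2 3}.
  apply: ae_forall_countable => // c.
  have [c0|c0] := pselect (0 < eta (cell c))%E.
    by apply: filterS (cell_pattern_ae c0).
  by apply: aeW => z /c0.
pose good z := [/\ forall c, cell c z -> (0 < eta (cell c))%E,
  forall c, cell c z <-> has_code c z &
  forall c, (0 < eta (cell c))%E -> exists2 B : 'I_(tag c) -> set X,
      (forall i, measurable (B i)) & pattern s (a_ z) B (tagged c).2 3].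
have ae_good : {ae eta, forall z, good z}.
  by apply: filterS3 cell_positive cell_code pat => z ? ? ?; split.
have wc z z' : good z -> good z' -> weakly_contained (a_ z) (a_ z').
  move=> [zpos zcode _] [_ _ zpat].
  apply: (weakly_contained_patterns sG mD); first exact: dD.
  move=> N t M p; pose c : code := existT _ N (t, M).
  have zc : cell c z by apply/zcode.
  exact: zpat (zpos _ zc).
have [z0 z0good] := ae_exists ae_good.
exists z0; apply: filterS ae_good => z zgood.
by split; exact: wc.
Qed.

End components.

Theorem theorem1p3 (R : realType)
    (G : groupType) (G_countable : countable [set: G])
    (d : measure_display) (X : measurableType d) (mu : probability X R)
    (X_standard : standard_borel R X) (mu_nonatomic : nonatomic mu)
    (a : mpaction G mu) (a_extreme : extreme_point (weq_class a))
    (dZ : measure_display) (Z : measurableType dZ) (eta : probability Z R)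
    (Z_standard : standard_borel R Z)
    (pi : X -> Z) (mu_ : Z -> pprobability X R)
    (a_ : forall z : Z, mpaction G (mu_ z))
    (a_dec : ergodic_decomposition a eta pi a_) :
  exists (dY : measure_display) (Y : measurableType dY)
    (nu : probability Y R) (b : mpaction G nu),
    standard_borel R Y /\
    {ae eta, forall z, weakly_equivalent (a_ z) b}.
Proof.
have [x0 _] : exists x : X, True by exact: (ae_exists (P := mu) (aeW _ _)).
have [D [mD dD]] := countable_dense x0 X_standard.
have [s sG] := countable_enum (1%g : G) G_countable.
have [z0 H] := components_weakly_equivalent G_countable X_standard mu_nonatomic
  a_extreme Z_standard a_dec (fun g => sG g Logic.I) mD dD.
by exists d, X, (mu_ z0), (a_ z0).
Qed.
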